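(* Consider the continuous-time system $\dot x(t)=A(t)x(t)+b(t)u(t)$, $y(t)=c(t)x(t)$, where $A(t)\in\mathbb{R}^{n\times n}$, $b(t)\in\mathbb{R}^{n\times1}$, $c(t)\in\mathbb{R}^{1\times n}$ have real-analytic entries in $t\in\mathbb{R}$. If the system is controllable and observable then, for a generic $c(t)$ and for all but countably many sampling periods $\delta>0$, the system is $\delta$-sample uniformly nullifiable by memoryless linear output feedback.
   Context: Controllability and observability are in the standard sense for linear time-varying continuous-time systems. ''Generic'' means: valid for an open and dense set of observation functions $c(\cdot)$ with respect to the supremum norm. Let $\Phi(t,s)$ be the fundamental (transition) matrix of $\dot x=A(t)x$. For $\delta>0$ and $t_k=k\delta$, the sampled-data system is the discrete-time system $x_{k+1}=A_\delta(k)x_k+b_\delta(k)u_k$, $y_k=c_\delta(k)x_k$ with $A_\delta(k)=\Phi(t_{k+1},t_k)$, $b_\delta(k)=\int_{t_k}^{t_{k+1}}\Phi(t_{k+1},s)b(s)\,ds$, $c_\delta(k)=c(t_k)$. A discrete-time system $(A_k,b_k,c_k)_{k\in\mathbb{Z}}$ is uniformly nullifiable by memoryless linear output feedback if there exist scalars $\{F_k\}_{k\in\mathbb{Z}}$ and $N\in\mathbb{N}$ such that for every $k\in\mathbb{Z}$ and every $x_k\in\mathbb{R}^n$, the dynamics $x_{j+1}=(A_j+F_jb_jc_j)x_j$ give $x_{k+N}=0$. The continuous system is $\delta$-sample uniformly nullifiable by memoryless linear output feedback if its sampled-data system with period $\delta$ is uniformly nullifiable by memoryless linear output feedback. *)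

(* Defs.v *)
From HB Require Import structures.
From mathcomp Require Import all_boot all_order all_algebra.
From mathcomp Require Import all_classical all_reals all_analysis.
Set Implicit Arguments. Unset Strict Implicit. Unset Printing Implicit Defensive.
Import Order.TTheory GRing.Theory Num.Theory.
Import numFieldNormedType.Exports.
Local Open Scope classical_set_scope.
Local Open Scope ring_scope.

Section Defs.
Variable R : realType.

Definition real_analytic (f : R -> R) : Prop :=
  forall t0 : R, exists2 r : R, 0 < r &
    exists a : nat -> R, forall t : R, `|t - t0| < r ->
      (fun N : nat => \sum_(k < N) a k * (t - t0) ^+ k) @ \oo --> f t.

Definition analytic_mx (p q : nat) (M : R -> 'M[R]_(p, q)) : Prop :=
  forall i j, real_analytic (fun t => M t i j).

Definition transition_matrix (n : nat) (A : R -> 'M[R]_n)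
    (Phi : R -> R -> 'M[R]_n) : Prop :=
  (forall s, Phi s s = 1%:M) /\
  (forall (t s : R) (i j : 'I_n),
      is_derive t (1 : R) (fun tau : R => Phi tau s i j) ((A t *m Phi t s) i j)).

Definition vint (n : nat) (a b : R) (f : R -> 'cV[R]_n) : 'cV[R]_n :=
  \col_i (\int[@lebesgue_measure R]_(s in `[a, b]) f s i 0).

(* Controllability (standard LTV sense): for every initial time t0 there is
   t1 > t0 such that every initial state x0 at t0 can be steered to 0 at t1,
   where the state at t1 is given by the variation-of-constants formula. *)
Definition lt_controllable (n : nat) (Phi : R -> R -> 'M[R]_n)
    (b : R -> 'cV[R]_n) : Prop :=
  forall t0 : R, exists2 t1 : R, t0 < t1 &
    forall x0 : 'cV[R]_n, exists2 u : R -> R, continuous u &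
      Phi t1 t0 *m x0 + vint t0 t1 (fun s => u s *: (Phi t1 s *m b s)) = 0.

Definition lt_observable (n : nat) (Phi : R -> R -> 'M[R]_n)
    (c : R -> 'rV[R]_n) : Prop :=
  forall t0 : R, exists2 t1 : R, t0 < t1 &
    forall x0 : 'cV[R]_n,
      (forall t, t0 <= t <= t1 -> c t *m (Phi t t0 *m x0) = 0) -> x0 = 0.

Fixpoint dtraj (n : nat) (Ad : int -> 'M[R]_n) (bd : int -> 'cV[R]_n)
    (cd : int -> 'rV[R]_n) (F : int -> R) (k : int) (m : nat)
    (x : 'cV[R]_n) : 'cV[R]_n :=
  match m with
  | 0%N => x
  | m'.+1 => let j := (k + m'%:Z)%R in
      (Ad j + F j *: (bd j *m cd j)) *m dtraj Ad bd cd F k m' x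
  end.

Definition unif_nullifiable (n : nat) (Ad : int -> 'M[R]_n)
    (bd : int -> 'cV[R]_n) (cd : int -> 'rV[R]_n) : Prop :=
  exists (F : int -> R) (N : nat),
    forall (k : int) (x : 'cV[R]_n), dtraj Ad bd cd F k N x = 0.

Definition samp_A (n : nat) (Phi : R -> R -> 'M[R]_n) (delta : R)
    (k : int) : 'M[R]_n :=
  Phi ((k + 1)%:~R * delta) (k%:~R * delta).
Definition samp_b (n : nat) (Phi : R -> R -> 'M[R]_n) (b : R -> 'cV[R]_n)
    (delta : R) (k : int) : 'cV[R]_n :=
  vint (k%:~R * delta) ((k + 1)%:~R * delta)
       (fun s => Phi ((k + 1)%:~R * delta) s *m b s).
Definition samp_c (n : nat) (c : R -> 'rV[R]_n) (delta : R) (k : int)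
    : 'rV[R]_n := c (k%:~R * delta).

Definition sample_nullifiable (n : nat) (Phi : R -> R -> 'M[R]_n)
    (b : R -> 'cV[R]_n) (c : R -> 'rV[R]_n) (delta : R) : Prop :=
  unif_nullifiable (samp_A Phi delta) (samp_b Phi b delta) (samp_c c delta).

(* Genericity: G is an open and dense subset of the space of real-analytic
   observation functions c(.) with respect to the supremum norm
   (entrywise sup over t in R). *)
Definition sup_open_dense (n : nat) (G : set (R -> 'rV[R]_n)) : Prop :=
  (forall c, G c -> analytic_mx c) /\
  (forall c, G c -> exists2 e : R, 0 < e &
     forall c', analytic_mx c' ->
       (forall t j, `|c' t 0 j - c t 0 j| < e) -> G c') /\
  (forall c : R -> 'rV[R]_n, analytic_mx c -> forall e : R, 0 < e ->
     exists2 c', G c' & forall t j, `|c' t 0 j - c t 0 j| < e).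

Definition countable_R (S : set R) : Prop :=
  exists f : nat -> R, forall x, S x -> exists k, f k = x.

End Defs.

(* Main.v *)
(* In the coordinates z = Phi(t,0)^-1 x the drift disappears: sampling gives
   z_{k+1} = (I + F_k g_k h_k) z_k, where g_k is the increment over
   [k delta, (k+1) delta] of a primitive of Phi(0,s) b(s) and
   h_k = c(k delta) Phi(k delta,0).

   Discrete part. Suppose that every window of L consecutive g's spans, every
   window of L consecutive h's spans, and h_i g_j <> 0 for all i, j. From x <> 0,
   choosing each feedback gain outside finitely many bad values moves the state
   off any finite set of hyperplanes within 2L steps; off a suitable finite set
   of hyperplanes, L further steps steer the state to 0. Doing this for the n
   basis vectors in turn produces a zero product over a block of 3nL steps, and
   these blocks tile Z.

   Analytic part. By controllability (observability) at time 0, the components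
   of the g-primitive together with 1 (of c Phi(.,0)) are linearly independent
   analytic functions, so finitely many of their Taylor coefficients at 0 span.
   A Vandermonde combination of samples at (k+j) delta recovers these
   coefficients to leading order in delta, so for each k the spanning
   condition is the non-vanishing of a nonzero analytic function of delta,
   which has countably many zeros. The leading coefficient of h_i g_j is a
   nonzero multiple of c(0) p, where p is the first nonvanishing Taylor
   coefficient of Phi(0,s) b(s) at 0; the generic set is { c | c(0) p <> 0 }. *)
Require Import Defs.
From HB Require Import structures.
From mathcomp Require Import all_boot all_order all_algebra.
From mathcomp Require Import all_classical all_reals all_analysis.
From mathcomp Require Import perm zify ring lra.
Import Order.TTheory GRing.Theory Num.Theory.
Import numFieldNormedType.Exports.
Local Open Scope classical_set_scope.
Local Open Scope ring_scope.

(** * Nullification of driftless discrete-time systems *)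

Section Discrete.
Context {R : realType} {n : nat}.
Implicit Types (A : int -> 'M[R]_n) (g : int -> 'cV[R]_n) (h : int -> 'rV[R]_n).

Lemma dtraj_eq A g h (F F' : int -> R) k m x :
  (forall j, k <= j < k + m%:Z -> F j = F' j) ->
  dtraj A g h F k m x = dtraj A g h F' k m x.
Proof.
elim: m => //= m IH FF'; rewrite IH ?FF' //; first by apply/andP; split; lia.
by move=> j /andP[j1 j2]; apply: FF'; apply/andP; split; lia.
Qed.

Lemma dtraj_cat A g h (F : int -> R) k m1 m2 x :
  dtraj A g h F k (m1 + m2) x =
  dtraj A g h F (k + m1%:Z) m2 (dtraj A g h F k m1 x).
Proof.
elim: m2 => [|m2 IH]; first by rewrite addn0.
by rewrite addnS /= IH PoszD addrA.
Qed.

Lemma dtraj0 A g h (F : int -> R) k m : dtraj A g h F k m 0 = 0.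
Proof. by elim: m => //= m ->; rewrite mulmx0. Qed.

Definition dot (q : 'rV[R]_n) (x : 'cV[R]_n) : R := (q *m x) 0 0.

Lemma dotD q x y : dot q (x + y) = dot q x + dot q y.
Proof. by rewrite /dot mulmxDr mxE. Qed.

Lemma dotZ q a x : dot q (a *: x) = a * dot q x.
Proof. by rewrite /dot -scalemxAr mxE. Qed.

Lemma dotDl q q' x : dot (q + q') x = dot q x + dot q' x.
Proof. by rewrite /dot mulmxDl mxE. Qed.

Lemma dotZl q a x : dot (a *: q) x = a * dot q x.
Proof. by rewrite /dot -scalemxAl mxE. Qed.

Lemma dotE q x : q *m x = (dot q x)%:M.
Proof. exact: mx11_scalar. Qed.

Lemma outer_mul (b : 'cV[R]_n) (c : 'rV[R]_n) (x : 'cV[R]_n) :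
  b *m c *m x = dot c x *: b.
Proof. by rewrite -mulmxA dotE mul_mx_scalar. Qed.

Section Reach.
Variables (g : int -> 'cV[R]_n) (h : int -> 'rV[R]_n).

(** The gains stay existentially quantified, so that windows can be treated one at a time and their
    gains glued afterwards. *)
Definition reach (k : int) (m : nat) (P : 'M[R]_n) :=
  exists F : int -> R, forall x, dtraj (fun=> 1%:M) g h F k m x = P *m x.

Lemma reach0 k : reach k 0 1%:M.
Proof. by exists (fun=> 0) => x /=; rewrite mul1mx. Qed.

Lemma reach1 k u : reach k 1 (1%:M + u *: (g k *m h k)).
Proof. by exists (fun=> u) => x /=; rewrite addr0. Qed.

Lemma reach_cat k m1 m2 P Q :
  reach k m1 P -> reach (k + m1%:Z) m2 Q -> reach k (m1 + m2) (Q *m P).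
Proof.
move=> [F1 H1] [F2 H2].
exists (fun j => if j < k + m1%:Z then F1 j else F2 j) => x.
rewrite dtraj_cat -mulmxA -H1 -H2.
rewrite (@dtraj_eq _ _ _ _ F1 k); last by move=> j /andP[_ ->].
by apply: dtraj_eq => j /andP[j1 _]; rewrite ltNge j1.
Qed.

Lemma reach_id k m : reach k m 1%:M.
Proof.
elim: m => [|m IH]; first exact: reach0.
rewrite -addn1 -[1%:M]mul1mx; apply: reach_cat IH _.
by have := reach1 (k + m%:Z) 0; rewrite scale0r addr0.
Qed.

Lemma mul_step k u x :
  (1%:M + u *: (g k *m h k)) *m x = x + (u * dot (h k) x) *: g k.
Proof. by rewrite mulmxDl mul1mx -scalemxAl outer_mul scalerA. Qed.

(** Each pair excludes at most one [u], so any [u] above the absolute values of all the quotients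
    will do. *)
Lemma exists_avoiding (s : seq (R * R)) :
  (forall p, p \in s -> (p.1 != 0) || (p.2 != 0)) ->
  exists u, forall p, p \in s -> p.1 + u * p.2 != 0.
Proof.
move=> sN0.
have [M M0 HM] : exists2 M : R, 0 < M & forall p, p \in s -> `|p.1 / p.2| < M.
  elim: s {sN0} => [|p s [M M0 HM]]; first by exists 1.
  exists (Num.max (`|p.1 / p.2| + 1) M); first by rewrite lt_max M0 orbT.
  move=> q; rewrite inE lt_max => /orP[/eqP ->|/HM ->]; last by rewrite orbT.
  by rewrite ltrDl ltr01.
exists M => p ps; apply/eqP => E.
have [p20|p20] := eqVneq p.2 0.
  by move: (sN0 p ps) E; rewrite p20 mulr0 addr0 eqxx orbF => /eqP.
have pM : p.1 / p.2 = - M.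
  by apply: (mulIf p20); rewrite divfK //; apply/eqP; rewrite mulNr -subr_eq0 opprK E.
by have := HM p ps; rewrite pM normrN gtr0_norm // ltxx.
Qed.

(** After the step, [dot q] is affine in the gain, with coefficients [dot q x] and
    [dot (h k) x * dot q (g k)]. One gain serves all of [Q]: no functional that is already nonzero
    is lost. *)
Lemma greedy_step k (Q : seq 'rV[R]_n) x :
  exists u, let y := (1%:M + u *: (g k *m h k)) *m x in
  forall q, q \in Q ->
    (dot q x != 0) || ((dot (h k) x != 0) && (dot q (g k) != 0)) -> dot q y != 0.
Proof.
have [hx0|hx0] := eqVneq (dot (h k) x) 0.
  exists 0 => y q _; rewrite andFb orbF.
  by rewrite /y mul_step mul0r scale0r addr0.
(* Affine functions that vanish identically are filtered out; no gain could avoid their zeros. *)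
pose s := [seq p <- [seq (dot q x, dot (h k) x * dot q (g k)) | q <- Q]
          | (p.1 != 0) || (p.2 != 0)].
have [|u Hu] := exists_avoiding s; first by move=> p; rewrite mem_filter => /andP[].
exists u => y q qQ H; rewrite /y mul_step dotD dotZ -mulrA.
apply: (Hu (dot q x, dot (h k) x * dot q (g k))).
rewrite mem_filter map_f // andbT /=.
by case/orP: H => [->//|/andP[_ gq]]; rewrite mulf_neq0 ?orbT.
Qed.

Lemma greedy_reach k (Q : seq 'rV[R]_n) x m :
  exists y : nat -> 'cV[R]_n, [/\ y 0%N = x,
   exists2 P, reach k m P & P *m x = y m &
   forall i, (i < m)%N -> forall q, q \in Q ->
     (dot q (y i) != 0) ||
     ((dot (h (k + i%:Z)) (y i) != 0) && (dot q (g (k + i%:Z)) != 0)) ->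
     dot q (y i.+1) != 0].
Proof.
elim: m => [|m [y [y0 [P rP Px] yS]]].
  by exists (fun=> x); split=> //; exists 1%:M; rewrite ?mul1mx //; exact: reach0.
have [u Hu] := greedy_step (k + m%:Z) Q (y m).
exists (fun i => if (i <= m)%N then y i else
   (1%:M + u *: (g (k + m%:Z) *m h (k + m%:Z))) *m y m); split=> //.
- exists ((1%:M + u *: (g (k + m%:Z) *m h (k + m%:Z))) *m P).
    by rewrite -addn1; apply: reach_cat rP _; exact: reach1.
  by rewrite ltnn -mulmxA Px.
- move=> i im q qQ; rewrite -ltnS im.
  have [im'|im'] := ltnP i m; first exact: yS.
  have -> : i = m by lia.
  exact: Hu.
Qed.

Variable L : nat.
Hypothesis g_span : forall k (q : 'rV[R]_n),
  (forall j, (j < L)%N -> dot q (g (k + j%:Z)) = 0) -> q = 0.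
Hypothesis h_span : forall k (x : 'cV[R]_n),
  (forall j, (j < L)%N -> dot (h (k + j%:Z)) x = 0) -> x = 0.
Hypothesis hg_neq0 : forall i j, dot (h i) (g j) != 0.

(** The [h] of the window join the functionals to be kept nonzero. One of the first [L] of them is
    nonzero at [x]; once its time has come, [hg_neq0] makes every [h] of the window nonzero from
    then on. In the last [L] steps each [q] then meets a [g] that it does not annihilate and becomes
    nonzero for good. *)
Lemma reach_avoiding k (Q : seq 'rV[R]_n) x :
  x != 0 -> (forall q, q \in Q -> q != 0) ->
  exists2 P, reach k (L + L) P & forall q, q \in Q -> dot q (P *m x) != 0.
Proof.
move=> x0 Q0.
pose H := [seq h (k + i%:Z) | i <- iota 0 (L + L)].
have [y [y0 [P rP Px] yS]] := greedy_reach k (Q ++ H) x (L + L).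
exists P => // q qQ; rewrite Px.
have mono r i j : r \in Q ++ H -> (i <= j)%N -> (j <= L + L)%N ->
    dot r (y i) != 0 -> dot r (y j) != 0.
  move=> rQ; elim: j => [|j IH]; first by rewrite leqn0 => /eqP ->.
  rewrite leq_eqVlt => /orP[/eqP -> //|ij] jL ri.
  by apply: yS => //; rewrite IH // ltnW.
have HQ i : (i < L + L)%N -> h (k + i%:Z) \in Q ++ H.
  by move=> iL; rewrite mem_cat orbC map_f // mem_iota.
have [i iL hx] : exists2 i, (i < L)%N & dot (h (k + i%:Z)) x != 0.
  apply: contrapT => N; case/eqP: x0; apply: (h_span k) => j jL.
  by apply/eqP; apply/negPn/negP => hj; apply: N; exists j.
have hi : dot (h (k + i%:Z)) (y i) != 0.
  by apply: (mono _ 0%N) => //; [apply: HQ; lia|lia|rewrite y0].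
have hall j : (j < L + L)%N -> dot (h (k + j%:Z)) (y i.+1) != 0.
  move=> jL; apply: yS; [lia|exact: HQ|].
  by rewrite hi hg_neq0 orbT.
have [j jL qg] : exists2 j, (j < L)%N & dot q (g (k + L%:Z + j%:Z)) != 0.
  apply: contrapT => N; case/eqP: (Q0 q qQ); apply: (g_span (k + L%:Z)) => j jL.
  by apply/eqP; apply/negPn/negP => hj; apply: N; exists j.
have qQH : q \in Q ++ H by rewrite mem_cat qQ.
apply: (mono q (L + j).+1) => //; first lia.
apply: yS => //; first lia.
rewrite PoszD addrA qg andbT; apply/orP; right.
rewrite -addrA -PoszD; apply: (mono _ i.+1); [apply: HQ; lia|lia|lia|].
by apply: hall; lia.
Qed.

(** Induction by prepending a step: [V] is the span of the [g] of the window, and [Q] collects the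
    hyperplanes to avoid. The first step removes the component of [x] along [g k] and leaves a
    vector of the previous [V]. The clause on [Q] makes each hyperplane proper in [V]. *)
Lemma kill_generic m k : exists (V : 'M[R]_n) (Q : seq 'rV[R]_n),
 [/\ forall j, (j < m)%N -> ((g (k + j%:Z))^T <= V)%MS,
   forall q, q \in Q -> exists2 v : 'cV[R]_n, (v^T <= V)%MS & dot q v != 0 &
   forall x : 'cV[R]_n, (x^T <= V)%MS -> (forall q, q \in Q -> dot q x != 0) ->
     exists2 P, reach k m P & P *m x = 0].
Proof.
elim: m k => [|m IH] k.
  exists 0, [::]; split=> // x; rewrite submx0 => /eqP xT0 _.
  exists 1%:M; first exact: reach0.
  by rewrite mul1mx -(trmxK x) xT0 trmx0.
have [V [Q [gV QV killV]]] := IH (k + 1).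
have gS V' : (V <= V')%MS -> ((g k)^T <= V')%MS ->
    forall j, (j < m.+1)%N -> ((g (k + j%:Z))^T <= V')%MS.
  move=> VV' gkV' [|j] jm; first by rewrite addr0.
  have -> : k + j.+1%:Z = k + 1 + j%:Z by lia.
  exact: submx_trans (gV j _) VV'.
have [gkV|gkV] := boolP ((g k)^T <= V)%MS.
  exists V, Q; split=> //; first exact: gS.
  move=> x xV xQ; have [P rP Px] := killV x xV xQ.
  exists P => //; rewrite -[P]mulmx1 -add1n.
  by apply: reach_cat rP; exact: reach_id.
(* A functional separating [g k] from [V]: a suitable column of the cokernel matrix, normalised. *)
have [phi phig phiV] : exists2 phi : 'rV[R]_n, dot phi (g k) = 1 &
    forall v : 'cV[R]_n, (v^T <= V)%MS -> dot phi v = 0.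
  move: gkV; rewrite submxE => /eqP gkV.
  have [i gi] : exists i, ((g k)^T *m cokermx V) 0 i != 0.
    apply: contrapT => N; apply: gkV; apply/rowP => i; rewrite [RHS]mxE.
    by apply/eqP/negPn/negP => gi; apply: N; exists i.
  have E v : dot (col i (cokermx V))^T v = (v^T *m cokermx V) 0 i.
    by rewrite /dot -[v in LHS]trmxK -trmx_mul colE mulmxA -colE !mxE.
  exists ((((g k)^T *m cokermx V) 0 i)^-1 *: (col i (cokermx V))^T).
    by rewrite dotZl E mulVf.
  by move=> v; rewrite submxE => /eqP vV; rewrite dotZl E vV [X in _ * X]mxE mulr0.
(* The gain acts only if [h k] is nonzero at [x]; the corrected functionals take at [x] the value of
   [q] at the [V]-component of [x]. *)
exists (V + (g k)^T)%MS,
  (h k :: [seq q - dot q (g k) *: phi | q <- Q]); split.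
- by apply: gS; [exact: addsmxSl|exact: addsmxSr].
- move=> q; rewrite inE => /orP[/eqP ->|/mapP[q' /QV[v vV qv] ->]].
    by exists (g k); [exact: addsmxSr|exact: hg_neq0].
  exists v; first exact: submx_trans vV (addsmxSl _ _).
  by rewrite dotDl -scaleNr dotZl phiV // mulr0 addr0.
- move=> x /sub_addsmxP[[u1 u2] /= Ex] Hx.
  pose v : 'cV[R]_n := (u1 *m V)^T.
  have vV : (v^T <= V)%MS by rewrite trmxK submxMl.
  have xE : x = v + u2 0 0 *: g k.
    apply: trmx_inj; rewrite Ex linearD /= trmxK linearZ /=; congr (_ + _).
    by rewrite [u2 in LHS]mx11_scalar mul_scalar_mx.
  have hx : dot (h k) x != 0 by apply: Hx; rewrite inE eqxx.
  have [|P rP Pv] := killV v vV.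
    move=> q qQ.
    have : dot (q - dot q (g k) *: phi) x != 0.
      by apply: Hx; rewrite inE; apply/orP; right; apply: map_f.
    rewrite xE dotDl -scaleNr dotZl !dotD !dotZ phig (phiV v vV) add0r mulr1.
    by rewrite mulNr [_ * u2 0 0]mulrC addrK.
  exists (P *m (1%:M + (- u2 0 0 / dot (h k) x) *: (g k *m h k))).
    by rewrite -add1n; apply: reach_cat rP; exact: reach1.
  by rewrite -mulmxA mul_step mulfVK // scaleNr {1}xE addrK.
Qed.

(** The first [2L] steps move the state off the hyperplanes that [kill_generic] attaches to the last
    [L] steps; there [V] is the whole space because the [g] span. *)
Lemma kill_vector k (x : 'cV[R]_n) :
  exists2 P, reach k (L + L + L) P & P *m x = 0.
Proof.
have [->|x0] := eqVneq x 0.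
  by exists 1%:M; [exact: reach_id|rewrite mulmx0].
have [V [Q [gV QV killV]]] := kill_generic L (k + (L + L)%N%:Z).
have V1 v : (v <= V)%MS.
  suff cV : cokermx V = 0 by rewrite submxE cV mulmx0.
  apply/matrixP => i j; rewrite [RHS]mxE.
  suff : (col j (cokermx V))^T = 0 by move/matrixP/(_ 0 i); rewrite !mxE.
  apply: (g_span (k + (L + L)%N%:Z)) => l lL.
  have := gV l lL; rewrite submxE => /eqP gE.
  by rewrite /dot -[g _]trmxK -trmx_mul colE mulmxA gE mul0mx trmx0 mxE.
have [q|P rP QP] := reach_avoiding k Q x x0.
  by move/QV=> [v _]; apply: contraNneq => ->; rewrite /dot mul0mx mxE.
have [||P' rP' P'x] := killV (P *m x) => //.
by exists (P' *m P); [exact: reach_cat|rewrite -mulmxA].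
Qed.

(** The images of the basis vectors are killed in turn; a zero column stays zero under further left
    multiplication. *)
Lemma reach_zero k : reach k (n * (L + L + L)) 0.
Proof.
have kill i : (i <= n)%N -> exists2 P, reach k (i * (L + L + L)) P &
    forall j : 'I_n, (j < i)%N -> col j P = 0.
  elim: i => [|i IH] ilen; first by exists 1%:M => //; rewrite mul0n; exact: reach0.
  have [P rP PC] := IH (ltnW ilen).
  have [P' rP' P'x] := kill_vector (k + (i * (L + L + L))%N%:Z) (col (Ordinal ilen) P).
  exists (P' *m P); first by rewrite mulSnr; exact: reach_cat.
  move=> j; rewrite ltnS leq_eqVlt colE -mulmxA -colE => /orP[/eqP ji|/PC ->]; last exact: mulmx0.
  by rewrite (_ : j = Ordinal ilen) //; exact: val_inj.
have [P rP PC] := kill n (leqnn n).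
suff <- : P = 0 by [].
apply/matrixP => i j; have := PC j (ltn_ord j) => /matrixP/(_ i 0).
by rewrite !mxE.
Qed.

(* One zeroing block of length [M] sits inside every window of length [2M]. *)
Lemma unif_nullifiable_spanning : unif_nullifiable (fun=> 1%:M) g h.
Proof.
pose M := (n * (L + L + L))%N.
have [M0|M0] := posnP M.
  exists (fun=> 0), 0%N => k x /=.
  by have [F /(_ x)] := reach_zero k; rewrite -/M M0 mul0mx.
have /choice[F HF] : forall b : int, exists F : int -> R,
    forall x, dtraj (fun=> 1%:M) g h F (b * M%:Z) M x = 0.
  by move=> b; have [F HF] := reach_zero (b * M%:Z); exists F => x; rewrite HF mul0mx.
exists (fun j => F (j %/ M)%Z j), (M + M)%N => k x.
(* [b * M] is the first block boundary strictly after [k], at most [M] steps away. *)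
pose b := ((k %/ M)%Z + 1)%R.
have kM := divz_eq k M; have rM : (0 <= (k %% M)%Z < M%:Z).
  by rewrite modz_ge0 ?ltz_pmod //; lia.
pose r := `|(k %% M)%Z|%N.
have rE : (k %% M)%Z = r%:Z by rewrite /r gez0_abs //; case/andP: rM.
rewrite rE in rM kM.
have -> : (M + M = (M - r) + (M + r))%N by lia.
rewrite dtraj_cat dtraj_cat.
have -> : k + (M - r)%N%:Z = b * M%:Z by rewrite /b mulrDl mul1r; lia.
rewrite [dtraj _ _ _ _ (b * M%:Z) M _](@dtraj_eq _ _ _ _ (F b)) ?HF ?dtraj0 //.
move=> j /andP[j1 j2].
congr (F _ j); have -> : j = b * M%:Z + (j - b * M%:Z) by rewrite addrC subrK.
by rewrite divzMDl ?divz_small ?addr0 //; lia.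
Qed.

End Reach.
End Discrete.

(** * Taylor coefficient functions *)

Section Jets.
Context {R : realType}.
Implicit Types (f g : R -> R) (D E : nat -> R -> R) (x C : R).

Lemma is_derive_add f g x a b : is_derive x (1 : R) f a ->
  is_derive x (1 : R) g b -> is_derive x (1 : R) (fun y => f y + g y) (a + b).
Proof. exact: is_deriveD. Qed.

Lemma is_derive_mul f g x a b : is_derive x (1 : R) f a ->
  is_derive x (1 : R) g b ->
  is_derive x (1 : R) (fun y => f y * g y) (a * g x + f x * b).
Proof.
move=> fa gb; apply: (is_derive_eq (is_deriveM fa gb)).
by rewrite addrC /GRing.scale /= [g x * a]mulrC.
Qed.

Lemma is_derive_bigsum (I : Type) (r : seq I) (F dF : I -> R -> R) x :
  (forall i, is_derive x (1 : R) (F i) (dF i x)) ->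
  is_derive x (1 : R) (fun y => \sum_(i <- r) F i y) (\sum_(i <- r) dF i x).
Proof.
move=> H; elim: r => [|i r IH].
  under eq_fun do rewrite big_nil.
  by rewrite big_nil; exact: is_derive_cst.
under eq_fun do rewrite big_cons.
by rewrite big_cons; exact: is_derive_add.
Qed.

Lemma is_derive_scale f k x a : is_derive x (1 : R) f a ->
  is_derive x (1 : R) (fun y => k * f y) (k * a).
Proof. exact: is_deriveZ. Qed.

Lemma is_derive_pow_rsub (c x : R) (m : nat) :
  is_derive x (1 : R) (fun y : R => (c - y) ^+ m) (- (m%:R * (c - x) ^+ m.-1)).
Proof.
have H : is_derive x (1 : R) (fun y : R => c - y) (- 1).
  by apply: (is_derive_eq (is_deriveB (is_derive_cst c x 1) (is_derive_id x 1))); rewrite sub0r.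
have -> : (fun y : R => (c - y) ^+ m) = (fun y : R => c - y) ^+ m.
  by apply/funext => y; rewrite exprfctE.
by apply: (is_derive_eq (is_deriveX m H)); rewrite /GRing.scale /= mulrN1.
Qed.

(* [D m] is the normalised derivative f^(m)/m!; one constant [C] serves both
   as inverse radius and as growth rate, so that it can be enlarged freely. *)
Definition jet_bound D x C :=
  1 <= C /\ forall y m, `|y - x| < C^-1 -> `|D m y| <= C ^+ m.+1.

(** Analyticity in derivative form: a locally uniform growth bound replaces convergence of power
    series and passes more easily through products and differential equations. *)
Definition jets f D :=
  [/\ D 0%N = f, forall m x, is_derive x (1 : R) (D m) (m.+1%:R * D m.+1 x) &
      forall x, exists C, jet_bound D x C].

Lemma jet_bound_le D x C C' : C <= C' -> jet_bound D x C -> jet_bound D x C'.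
Proof.
move=> CC' [C1 H]; have C'1 := le_trans C1 CC'; split=> // y m yx.
have C0 : 0 < C by lra.
have C'0 : 0 < C' by lra.
apply: le_trans (H y m _) _; last first.
  by apply: lerXn2r; rewrite ?nnegrE //; apply: ltW.
by apply: lt_le_trans yx _; rewrite lef_pV2.
Qed.

Lemma MVT_sym (g dg : R -> R) (a b : R) :
  (forall x, is_derive x (1 : R) g (dg x)) ->
  exists c, [/\ `|b - c| <= `|b - a|, `|c - a| <= `|b - a| &
     g b - g a = dg c * (b - a)].
Proof.
move=> H.
have cont (u v : R) : {within `[u, v], continuous g}.
  apply: continuous_subspaceT => x.
  by apply/differentiable_continuous/derivable1_diffP; case: (H x).
have [ab|ba] := leP a b.
  have [c] := MVT_segment ab (fun x _ => H x) (cont a b).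
  rewrite in_itv /= => /andP[ac cb] E; exists c; split=> //.
    by rewrite !ger0_norm; lra.
  by rewrite !ger0_norm; lra.
have [c] := MVT_segment (ltW ba) (fun x _ => H x) (cont b a).
rewrite in_itv /= => /andP[ac cb] E; exists c; split=> //.
- by rewrite !ler0_norm; lra.
- by rewrite !ler0_norm; lra.
- by apply: oppr_inj; rewrite opprB E; ring.
Qed.

(** As a function of its base point [s], the Taylor polynomial evaluated at [y] has a derivative
    that telescopes to one term; the mean value theorem between [x] and [y] bounds the remainder.
    The last summand covers [M = 0]. *)
Lemma taylor_bound f D x C y M : jets f D -> jet_bound D x C ->
  `|y - x| < C^-1 ->
  `|f y - \sum_(m < M) D m x * (y - x) ^+ m| <=
     (M%:R * C ^+ M.+1 * `|y - x| ^+ M) + (M == 0%N)%:R * C.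
Proof.
move=> [D0 dD _] [C1 BD] yx.
case: M => [|M].
  rewrite big_ord0 subr0 !mul0r add0r mul1r -D0; exact: (BD y 0%N yx).
rewrite mul0r addr0.
pose G (s : R) := \sum_(m < M.+1) D m s * (y - s) ^+ m.
have dG s : is_derive s (1 : R) G (M.+1%:R * D M.+1 s * (y - s) ^+ M).
  rewrite /G; elim: M {G} => [|M IH].
    under eq_fun do rewrite big_ord1 expr0 mulr1.
    by rewrite expr0 mulr1; exact: dD.
  under eq_fun do rewrite big_ord_recr /=.
  apply: is_derive_eq (is_derive_add _ _ _ _ _ IH
     (is_derive_mul _ _ _ _ _ (dD _ _) (is_derive_pow_rsub y s M.+1))) _.
  by rewrite /=; ring.
have [c [c1 c2 E]] := MVT_sym G _ x y dG.
have Gy : G y = f y.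
  rewrite /G big_ord_recl /= expr0 mulr1 D0 big1 ?addr0 // => i _.
  by rewrite subrr expr0n mulr0.
rewrite -Gy -/(G x) E !normrM normr_nat normrX [`|y - x| ^+ M.+1]exprSr.
have := BD c M.+1 (le_lt_trans c2 yx); move: (C ^+ M.+2) => K BDc.
rewrite -!mulrA ler_wpM2l // ler_pM ?mulr_ge0 ?exprn_ge0 //.
by rewrite ler_wpM2r //; apply: lerXn2r; rewrite ?nnegrE.
Qed.

Lemma pow4_le (M : nat) : M%:R * (1 / 4 : R) ^+ M <= (1 / 2) ^+ M.
Proof.
have -> : (1 / 4 : R) = 1 / 2 * (1 / 2) by lra.
have h0 : 0 <= (1 / 2 : R) by lra.
rewrite exprMn mulrA ler_piMl ?exprn_ge0 //.
rewrite expr_div_n expr1n mul1r ler_pdivrMr ?exprn_gt0 // mul1r -natrX ler_nat.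
exact/ltnW/ltn_expl.
Qed.

Lemma le_pow_half_eq0 (a c : R) : 0 <= a ->
  (forall M : nat, a <= c * (1 / 2) ^+ M) -> a = 0.
Proof.
move=> a0 H; apply/eqP; rewrite eq_le a0 andbT leNgt; apply/negP => a1.
have c0 : 0 <= c by have := H 0%N; rewrite expr0 mulr1; lra.
have := archi_boundP (divr_ge0 c0 a0); set M := Num.bound _ => cM.
have := H M; rewrite leNgt => /negP; apply.
rewrite expr_div_n expr1n mul1r ltr_pdivrMr ?exprn_gt0 //.
move: cM; rewrite ltr_pdivrMr // mulrC => /lt_le_trans; apply.
by rewrite ler_wpM2l // -natrX ler_nat ltnW // ltn_expl.
Qed.

(** All Taylor polynomials at [x] vanish, so each remainder bounds [f y]. Within a quarter of the
    radius, the remainder of order [M > 0] is at most [C * M / 4 ^ M <= C / 2 ^ M]. *)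
Lemma jets_near0 f D x : jets f D -> (forall m, D m x = 0) ->
  exists2 e, 0 < e & forall y, `|y - x| < e -> f y = 0.
Proof.
move=> Df D0; have [_ _ /(_ x)[C BC]] := Df; have [C1 _] := BC.
have C0 : 0 < C by lra.
exists (C^-1 / 4); first by rewrite divr_gt0 ?invr_gt0.
move=> y yx; apply/eqP; rewrite -normr_eq0; apply/eqP.
apply: (@le_pow_half_eq0 _ (C + C)) => // M.
have yC : `|y - x| < C^-1.
  by apply: lt_le_trans yx _; have : 0 < C^-1 by [rewrite invr_gt0]; lra.
have := taylor_bound f D x C y M Df BC yC.
rewrite big1 ?subr0; last by move=> i _; rewrite D0 mul0r.
move=> /le_trans; apply; rewrite mulrDl lerD //; last first.
  by case: M => [|M]; rewrite ?mul1r ?mulr1 // mul0r mulr_ge0 ?exprn_ge0 //; lra.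
have -> : M%:R * C ^+ M.+1 * `|y - x| ^+ M = C * (M%:R * (C * `|y - x|) ^+ M).
  by rewrite exprMn exprS; ring.
apply: ler_wpM2l; first by lra.
apply: le_trans (pow4_le M); apply: ler_wpM2l => //.
have q4 : 0 <= (1 / 4 : R) by lra.
have C0' : 0 <= C by lra.
apply: lerXn2r; rewrite ?nnegrE ?mulr_ge0 //.
have -> : 1 / 4 = C * (C^-1 / 4) by rewrite mulrA divff // gt_eqF.
by apply: ler_wpM2l; [lra|exact: ltW].
Qed.

(** The term of order [p] dominates the remainder of order [p.+1] once [y] is close enough to
    [x]. *)
Lemma jets_isolated f D x p : jets f D ->
  (forall m, (m < p)%N -> D m x = 0) -> D p x != 0 ->
  exists2 e, 0 < e & forall y, 0 < `|y - x| -> `|y - x| < e -> f y != 0.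
Proof.
move=> Df D0 Dp; have [_ _ /(_ x)[C BC]] := Df; have [C1 _] := BC.
have C0 : 0 < C by lra.
pose a := p.+1%:R * C ^+ p.+2.
have a0 : 0 < a by rewrite mulr_gt0 ?exprn_gt0.
exists (Num.min C^-1 (`|D p x| / a)).
  by rewrite lt_min invr_gt0 C0 divr_gt0 ?normr_gt0.
move=> y y0; rewrite lt_min => /andP[yC ya].
have := taylor_bound f D x C y p.+1 Df BC yC.
rewrite big_ord_recr /= big1 ?add0r; last by move=> i _; rewrite D0 ?mul0r.
rewrite mul0r addr0 -/a => H; apply/eqP => fy.
move: H; rewrite fy sub0r normrN normrM normrX exprSr mulrA leNgt => /negP; apply.
rewrite mulrAC -subr_gt0 -mulrBl mulr_gt0 ?exprn_gt0 // subr_gt0.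
by rewrite mulrC -ltr_pdivlMr.
Qed.

End Jets.

(** * Identity theorem, countability of zeros, operations on jets *)

Section JetCalculus.
Context {R : realType}.
Implicit Types (f g : R -> R) (D E : nat -> R -> R) (x C : R).

Lemma jets_continuous f D m : jets f D -> continuous (D m).
Proof.
move=> [_ dD _] x.
by apply/differentiable_continuous/derivable1_diffP; case: (dD m x).
Qed.

Lemma is_derive_uniq f x a b :
  is_derive x (1 : R) f a -> is_derive x (1 : R) f b -> a = b.
Proof. by move=> [_ <-] [_ <-]. Qed.

(** The set where all coefficients vanish is open, since [f] and then its derivatives vanish nearby,
    closed by continuity of each [D m], and nonempty; the line is connected. *)
Lemma jets_eq0 f D x : jets f D -> (forall m, D m x = 0) ->
  forall y, f y = 0.
Proof.
move=> Df D0; have [Df0 dD _] := Df.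
pose S := [set y | forall m, D m y = 0].
have oS : open S.
  rewrite openE => y Sy; have [e e0 He] := jets_near0 _ _ _ Df Sy.
  apply/nbhs_ballP; exists e => // z; rewrite /ball /= distrC => zy m.
  elim: m z zy => [|m IH] z zy; first by rewrite Df0 He.
  have : m.+1%:R * D m.+1 z = 0.
    apply: is_derive_uniq (dD m z) _.
    apply: (near_eq_is_derive _ (is_derive_cst (0 : R) z (1 : R))).
    have [d d0 Hd] : exists2 d, 0 < d & d <= e - `|z - y|.
      by exists (e - `|z - y|); rewrite // subr_gt0.
    apply/nbhs_ballP; exists d => // w; rewrite /ball /= distrC => wz.
    rewrite IH //; have := ler_normD (w - z) (z - y).
    by rewrite addrA subrK; lra.
  by move/eqP; rewrite mulf_eq0 pnatr_eq0 /= => /eqP.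
have cS : closed S.
  have -> : S = \bigcap_(m in setT) (D m @^-1` [set 0]).
    by apply/seteqP; split=> [z Sz m _|z Sz m]; [exact: Sz|exact: (Sz m I)].
  apply: closed_bigI => m _; apply: preimage_closed.
    by move=> z _; exact: (jets_continuous _ _ _ Df).
  exact: closed_eq.
have cT : connected [set: R] by apply/connected_intervalP.
have ST : S = setT.
  apply: cT; first by exists x.
  - by exists S; rewrite ?setTI.
  - by exists S; rewrite ?setTI.
move=> y; have : S y by rewrite ST.
by move/(_ 0%N); rewrite Df0.
Qed.

Lemma countable_R_exists (T : countType) (S : T -> set R) :
  (forall i, countable_R (S i)) -> countable_R [set x | exists i, S i x].
Proof.
move=> /choice[F HF].
exists (fun k => if @unpickle (T * nat)%type k is Some p then F p.1 p.2 else 0).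
by move=> x [i /HF[l <-]]; exists (pickle (i, l)); rewrite pickleK.
Qed.

Lemma countable_R_sub (S T : set R) : S `<=` T -> countable_R T -> countable_R S.
Proof. by move=> ST [F HF]; exists F => x /ST/HF. Qed.

Lemma countable_R_U (S T : set R) :
  countable_R S -> countable_R T -> countable_R (S `|` T).
Proof.
move=> cS cT; have := countable_R_exists bool (fun i => if i then S else T).
move=> /(_ (fun i => if i as i' return countable_R (if i' then S else T) then cS else cT)).
apply: countable_R_sub => x [Sx|Tx]; [by exists true|by exists false].
Qed.

(** Zeros are isolated, so each is the only zero in some interval with rational end points and is
    recovered from that pair. *)
Lemma countable_zeros f D : jets f D -> (exists x, f x != 0) ->
  countable_R [set x | f x = 0].
Proof.
move=> Df [x0 fx0].
(* The default 0, for intervals without zeros, is harmless: an enumeration may contain extra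
   points. *)
pose pt (p : rat * rat) :=
  xget (0 : R) [set z | [/\ ratr p.1 < z, z < ratr p.2 & f z = 0]].
exists (fun k => if @unpickle (rat * rat)%type k is Some p then pt p else 0).
move=> x /= fx.
have exD : exists m, D m x != 0.
  apply: contrapT => N; move/eqP: fx0; apply.
  apply: (jets_eq0 _ _ x Df) => m; apply/eqP/negPn/negP => Dm; apply: N.
  by exists m.
have [e e0 He] : exists2 e, 0 < e & forall y, 0 < `|y - x| -> `|y - x| < e -> f y != 0.
  apply: (jets_isolated _ _ _ (ex_minn exD) Df); case: ex_minnP => //= p _ Hp m mp.
  by apply/eqP/negPn/negP => /Hp; rewrite leqNgt mp.
have [p] := @rat_in_itvoo R (x - e) x ltac:(by rewrite ltrBlDr ltrDl).
have [q] := @rat_in_itvoo R x (x + e) ltac:(by rewrite ltrDl).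
rewrite !in_itv /= => /andP[xq qe] /andP[ep px].
exists (pickle (p, q)); rewrite pickleK /pt /=.
apply: xget_unique => // z [/= pz zq fz]; apply/eqP.
rewrite -subr_eq0 -normr_eq0 eq_le normr_ge0 andbT leNgt; apply/negP => zx.
by move: (He z zx); rewrite fz eqxx ltr_distl => /(_ ltac:(lra)).
Qed.

Lemma jets_cst (a : R) : jets (fun=> a) (fun m _ => if m is 0%N then a else 0).
Proof.
split=> //.
- by case=> [|m] x; rewrite mulr0; exact: is_derive_cst.
- move=> x; exists (1 + `|a|); split; first by rewrite lerDl.
  move=> y [|m] _; first by rewrite expr1 lerDr.
  by rewrite normr0 exprn_ge0 // addr_ge0.
Qed.

Lemma jets_id : jets id (fun m (x : R) => if m is 0%N then x else (m == 1%N)%:R).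
Proof.
split=> //.
- by case=> [|[|m]] x /=; rewrite ?mulr0 ?mulr1;
    [exact: is_derive_id|exact: is_derive_cst..].
- move=> x; have x1 : 1 <= `|x| + 1 by rewrite lerDr.
  exists (`|x| + 1); split=> // y [|m]; last first.
    rewrite normr_nat => _; apply: (@le_trans _ _ 1); last exact: exprn_ege1.
    by rewrite lern1; case: eqP.
  rewrite expr1 => /lt_le_trans yx.
  have {yx} : `|y - x| < 1 by apply: yx; rewrite invf_le1 // ltr_wpDl.
  by have := ler_normD (y - x) x; rewrite subrK; lra.
Qed.

Lemma jet_bound_common D E x : (exists C, jet_bound D x C) ->
  (exists C, jet_bound E x C) -> exists C, jet_bound D x C /\ jet_bound E x C.
Proof.
move=> [C HC] [C' HC']; exists (C + C').
by split; [apply: (jet_bound_le _ _ C)|apply: (jet_bound_le _ _ C')] => //;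
  case: HC => ? _; case: HC' => ? _; lra.
Qed.

Lemma jets_add f g D E : jets f D -> jets g E ->
  jets (fun x => f x + g x) (fun m x => D m x + E m x).
Proof.
move=> [<- dD BD] [<- dE BE]; split=> //.
- by move=> m x; rewrite mulrDr; exact: is_derive_add.
- move=> x; have [C [[C1 HD] [_ HE]]] := jet_bound_common _ _ _ (BD x) (BE x).
  exists (C + C); split=> [|y m yx]; first lra.
  have yC : `|y - x| < C^-1.
    by apply: lt_le_trans yx _; rewrite lef_pV2 ?posrE; lra.
  apply: le_trans (ler_normD _ _) _.
  apply: (@le_trans _ _ (C ^+ m.+1 + C ^+ m.+1)); first by rewrite lerD ?HD ?HE.
  have -> : C + C = 2 * C by ring.
  rewrite exprMn -mulr2n -[X in X <= _]mulr_natl ler_wpM2r ?exprn_ge0 //; first lra.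
  by rewrite exprS ler_peMr // exprn_ege1 //; lra.
Qed.

(** Leibniz's rule for normalised derivatives is a Cauchy product, without binomial coefficients. *)
Definition conv (D E : nat -> R -> R) (m : nat) (x : R) :=
  \sum_(i < m.+1) D i x * E (m - i)%N x.

Lemma conv_derive (a b : nat -> R) m :
  \sum_(i < m.+1) (i.+1%:R * a i.+1 * b (m - i)%N +
                   a i * ((m - i).+1%:R * b (m - i).+1)) =
  m.+1%:R * \sum_(i < m.+2) a i * b (m.+1 - i)%N.
Proof.
rewrite big_split /=.
have -> : \sum_(i < m.+1) i.+1%:R * a i.+1 * b (m - i)%N =
    \sum_(i < m.+2) i%:R * (a i * b (m.+1 - i)%N).
  rewrite [RHS]big_ord_recl mul0r add0r; apply: eq_bigr => i _.
  by rewrite !lift0 subSS mulrA.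
have -> : \sum_(i < m.+1) a i * ((m - i).+1%:R * b (m - i).+1) =
    \sum_(i < m.+2) (m.+1 - i)%:R * (a i * b (m.+1 - i)%N).
  rewrite [RHS]big_ord_recr /= subnn mul0r addr0; apply: eq_bigr => i _.
  by rewrite subSn -1?ltnS // mulrCA.
rewrite -big_split mulr_sumr; apply: eq_bigr => i _ /=.
by rewrite -mulrDl -natrD subnKC // -ltnS.
Qed.

Lemma jets_mul f g D E : jets f D -> jets g E ->
  jets (fun x => f x * g x) (conv D E).
Proof.
move=> [<- dD BD] [<- dE BE]; split.
- by apply/funext => x; rewrite /conv big_ord1.
- move=> m x; rewrite /conv.
  apply: (is_derive_eq _ (conv_derive (fun i => D i x) (fun i => E i x) m)).
  apply: (is_derive_bigsum _ _ (fun (i : 'I_m.+1) y => D i y * E (m - i)%N y)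
    (fun (i : 'I_m.+1) y => i.+1%:R * D i.+1 y * E (m - i)%N y +
        D i y * ((m - i).+1%:R * E (m - i).+1 y)) x) => i.
  exact: is_derive_mul.
- move=> x; have [C [[C1 HD] [_ HE]]] := jet_bound_common _ _ _ (BD x) (BE x).
  have C11 : C <= C * C by rewrite ler_peMr //; lra.
  (* There are [m.+1] products, each at most [C ^ m.+2]: the factor 2 pays for their number, the
     square for the excess exponent. *)
  exists (2 * (C * C)); split=> [|y m yx]; first lra.
  have yC : `|y - x| < C^-1.
    by apply: lt_le_trans yx _; rewrite lef_pV2 ?posrE; lra.
  apply: le_trans (ler_norm_sum _ _ _) _.
  apply: (@le_trans _ _ (\sum_(i < m.+1) C ^+ m.+2)).
    apply: ler_sum => i _; rewrite normrM.
    have -> : m.+2 = (i.+1 + (m - i).+1)%N by have := ltn_ord i; lia.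
    by rewrite exprD ler_pM ?HD ?HE.
  rewrite sumr_const card_ord exprMn -[X in X <= _]mulr_natl.
    apply: ler_pM => //; first by rewrite exprn_ge0 //; lra.
    by rewrite -natrX ler_nat ltnW // ltn_expl.
  by rewrite -expr2 -exprM ler_weXn2l //; lia.
Qed.

Lemma jets_scale f D a : jets f D ->
  jets (fun x => f (a * x)) (fun m x => a ^+ m * D m (a * x)).
Proof.
move=> [<- dD BD]; split.
- by apply/funext => x; rewrite mul1r.
- move=> m x; have -> : m.+1%:R * (a ^+ m.+1 * D m.+1 (a * x)) =
      a ^+ m * (m.+1%:R * D m.+1 (a * x) * a) by rewrite exprS; ring.
  apply: is_derive_scale.
  apply: (is_derive1_comp (dD m (a * x))).
  by apply: (is_derive_eq (is_derive_scale _ a _ _ (is_derive_id x (1 : R)))); rewrite mulr1.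
- move=> x; have [C [C1 HC]] := BD (a * x).
  have Ca : C <= C * (1 + `|a|) by rewrite ler_peMr ?lerDl //; lra.
  exists (C * (1 + `|a|)); split=> [|y m yx]; first lra.
  have yC : `|a * y - a * x| < C^-1.
    rewrite -mulrBr normrM.
    have : (1 + `|a|) * `|y - x| < C^-1.
      by rewrite mulrC -ltr_pdivlMr ?ltr_pwDl // -invfM.
    by apply: le_lt_trans; rewrite ler_wpM2r // lerDr.
  rewrite normrM normrX mulrC exprMn; apply: ler_pM => //; first exact: HC.
  apply: (@le_trans _ _ ((1 + `|a|) ^+ m)).
    by apply: lerXn2r; rewrite ?nnegrE ?addr_ge0 // lerDr.
  by rewrite ler_weXn2l // lerDl.
Qed.

End JetCalculus.

(** * Power series *)

Section PowerSeries.
Context {R : realType}.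
Implicit Types (a : nat -> R) (M s x : R).

Definition geom_bound a M s := forall k, `|a k| <= M * s ^+ k.

Definition psum a x : R := limn (pseries a x).

Lemma geom_bound_series a M s x : 0 <= s -> geom_bound a M s -> s * `|x| < 1 ->
  cvgn (series (fun k => `|a k * x ^+ k|)) /\
  `|psum a x| <= M / (1 - s * `|x|).
Proof.
move=> s0 Ha sx.
have sx0 : 0 <= s * `|x| by rewrite mulr_ge0.
have M0 : 0 <= M by have := Ha 0%N; rewrite expr0 mulr1; apply: le_trans.
have nsx : `|s * `|x| | < 1 by rewrite ger0_norm.
have le k : `|a k * x ^+ k| <= geometric M (s * `|x|) k.
  by rewrite /= normrM normrX exprMn mulrA ler_wpM2r ?exprn_ge0.
have cg := @is_cvg_geometric_series R M _ nsx.
have cn : cvgn (series (fun k => `|a k * x ^+ k|)).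
  by apply: series_le_cvg cg => // k; rewrite /= mulr_ge0 ?exprn_ge0.
split=> //; apply: le_trans (lim_series_norm cn) _.
apply: le_trans (lim_series_le cn cg le) _.
by rewrite (cvg_lim _ (cvg_geometric_series nsx)).
Qed.

Lemma geom_bound_cvg a M s x : 0 <= s -> geom_bound a M s -> s * `|x| < 1 ->
  cvgn (pseries a x).
Proof.
by move=> s0 Ha sx; apply: normed_cvg; have [] := geom_bound_series a M s x s0 Ha sx.
Qed.

Lemma geom_bound_diffs a M s : 0 <= s -> geom_bound a M s ->
  geom_bound (pseries_diffs a) (M * s) (2 * s).
Proof.
move=> s0 Ha k; rewrite /pseries_diffs normrM normr_nat exprMn.
have -> : M * s * (2 ^+ k * s ^+ k) = 2 ^+ k * (M * s ^+ k.+1).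
  by rewrite exprS; ring.
by apply: ler_pM => //; rewrite -natrX ler_nat ltn_expl.
Qed.

Lemma is_derive_psum a M s x : 0 < s -> geom_bound a M s -> `|x| < (8 * s)^-1 ->
  is_derive x (1 : R) (psum a) (psum (pseries_diffs a) x).
Proof.
(* Termwise differentiation needs convergence at [K] of the series and of its first two formal
   derivatives, whose rates go up to [4 * s]. *)
move=> s0 Ha xs; pose K := (8 * s)^-1.
have K0 : 0 < K by rewrite invr_gt0; lra.
have s0' := ltW s0.
have Ha1 := geom_bound_diffs _ _ _ s0' Ha.
have s2 : 0 <= 2 * s by lra.
have Ha2 := geom_bound_diffs _ _ _ s2 Ha1.
have KE : 8 * s * `|K| = 1 by rewrite gtr0_norm // divff // gt_eqF //; lra.
apply: (@pseries_snd_diffs R a K); last by rewrite [X in _ < X]gtr0_norm.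
- by apply: geom_bound_cvg Ha _ => //; nra.
- by apply: geom_bound_cvg Ha1 _ => //; nra.
- by apply: geom_bound_cvg Ha2 _ => //; nra.
Qed.

(** Coefficients of the normalised [m]-th derivative of the power series of [a]. *)
Definition taylor_shift a (m k : nat) : R := 'C(k + m, m)%:R * a (k + m)%N.

Lemma bin_le_exp2 n m : ('C(n, m) <= 2 ^ n)%N.
Proof.
elim: n m => [|n IH] [|m]; rewrite ?bin0 ?expn_gt0 //.
by rewrite binS expnS mul2n -addnn leq_add.
Qed.

(** The rate [2 * s] is the same for all [m], so that one radius serves every derivative. *)
Lemma geom_bound_shift a M s m : 0 <= s -> geom_bound a M s ->
  geom_bound (taylor_shift a m) (M * (2 * s) ^+ m) (2 * s).
Proof.
move=> s0 Ha k; rewrite /taylor_shift normrM normr_nat.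
have -> : M * (2 * s) ^+ m * (2 * s) ^+ k = 2 ^+ (k + m) * (M * s ^+ (k + m)).
  by rewrite -mulrA -exprD exprMn [(m + k)%N]addnC; ring.
by apply: ler_pM => //; rewrite -natrX ler_nat bin_le_exp2.
Qed.

Lemma shift_diffs a m :
  pseries_diffs (taylor_shift a m) = m.+1%:R *: taylor_shift a m.+1.
Proof.
apply/funext => k; rewrite /pseries_diffs /taylor_shift !fctE /GRing.scale /=.
rewrite addSnnS !mulrA -!natrM mul_bin_left; congr (_%:R * _).
by congr (_ * _)%N; lia.
Qed.

Lemma is_derive_psum_shift a M s m x : 0 < s -> geom_bound a M s ->
  `|x| < (16 * s)^-1 ->
  is_derive x (1 : R) (psum (taylor_shift a m))
    (m.+1%:R * psum (taylor_shift a m.+1) x).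
Proof.
move=> s0 Ha xs.
have s20 : 0 < 2 * s by lra.
have xs2 : `|x| < (8 * (2 * s))^-1 by rewrite mulrA -natrM.
have Hm := geom_bound_shift a M s m (ltW s0) Ha.
have Hm1 := geom_bound_shift a M s m.+1 (ltW s0) Ha.
apply: (is_derive_eq (is_derive_psum _ _ _ _ s20 Hm xs2)).
rewrite shift_diffs /psum -[RHS]/(_ *: _) -lim_seriesZ.
  congr (limn _); apply/funext => n; rewrite /pseries /series /=.
  by apply: eq_bigr => i _; exact/esym/mulrA.
apply: (geom_bound_cvg _ _ _ _ _ Hm1); first lra.
have : 16 * s * `|x| < 1.
  by rewrite mulrC -ltr_pdivlMr ?mul1r //; lra.
by have := normr_ge0 x; nra.
Qed.

(** Convergence at [t0 + r / 2] bounds the terms there, which bounds the coefficients geometrically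
    with rate [2 / r]. *)
Lemma local_power_series (f : R -> R) t0 r a : 0 < r ->
  (forall t, `|t - t0| < r ->
     (fun N : nat => \sum_(k < N) a k * (t - t0) ^+ k) @ \oo --> f t) ->
  exists M s, [/\ 1 <= M, 1 <= s, geom_bound a M s &
    forall t, `|t - t0| < (16 * s)^-1 -> f t = psum a (t - t0)].
Proof.
move=> r0 Hf.
have E t : (fun N : nat => \sum_(k < N) a k * (t - t0) ^+ k) = pseries a (t - t0).
  by apply/funext => N; rewrite /pseries /series /= big_mkord.
have cv : cvgn (pseries a (r / 2)).
  have := Hf (t0 + r / 2); rewrite E addrAC subrr add0r => H.
  by apply: cvgP; apply: H; rewrite gtr0_norm; lra.
have [K [Kreal Kf]] := cvg_series_bounded cv.
pose M := 1 + `|K|; have MK : K < M by rewrite ltr_pwDl // ler_norm.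
pose s := Num.max 1 (2 / r).
have s1 : 1 <= s by rewrite le_max lexx.
have sr : 2 / r <= s by rewrite le_max lexx orbT.
have r20 : 0 < 2 / r by rewrite divr_gt0.
exists M, s; split=> //; first by rewrite lerDl.
- move=> k; have : `|a k * (r / 2) ^+ k| <= M := Kf M MK k I; rewrite normrM normrX => H.
  apply: (@le_trans _ _ (M * (2 / r) ^+ k)); last first.
    rewrite ler_wpM2l // ?addr_ge0 //; apply: lerXn2r; rewrite ?nnegrE //; lra.
  rewrite -[2 / r]invf_div exprVn -ler_pdivrMr ?invr_gt0 ?exprn_gt0 ?divr_gt0 //.
  by rewrite invrK; move: H; rewrite [`|r / 2|]gtr0_norm // divr_gt0.
- move=> t tr; apply/esym; rewrite /psum -E; apply: cvg_lim => //; apply: Hf.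
  apply: lt_le_trans tr _.
  rewrite -[X in _ <= X]invrK lef_pV2 ?posrE ?invr_gt0 //; last lra.
  by have : 2 / r = 2 * r^-1 by []; lra.
Qed.

(** Iterated derivatives over factorials are a global choice of jets. Around each point they agree
    with the shifted local series, by induction on the order, which yields the derivative rule and
    the growth bound. *)
Lemma real_analytic_jets (f : R -> R) : real_analytic f -> exists D, jets f D.
Proof.
move=> af; exists (fun m t => (m`!%:R)^-1 * derive1n m f t).
pose D m t := (m`!%:R)^-1 * derive1n m f t; rewrite -/D.
have fac0 m : m`!%:R != 0 :> R by rewrite pnatr_eq0 -lt0n fact_gt0.
have loc t0 : exists M s a, [/\ 1 <= M, 1 <= s, geom_bound a M s &
    forall m t, `|t - t0| < (16 * s)^-1 -> D m t = psum (taylor_shift a m) (t - t0)].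
  have [r r0 [a Ha]] := af t0.
  have [M [s [M1 s1 ga fE]]] := local_power_series f t0 r a r0 Ha.
  exists M, s, a; split=> //.
  elim=> [|m IH] t ts.
    rewrite /D fact0 invr1 mul1r /= fE //; congr psum; apply/funext => k.
    by rewrite /taylor_shift addn0 bin0 mul1r.
  have s0 : 0 < s by lra.
  suff H : is_derive t (1 : R) (derive1n m f)
      (m`!%:R * (m.+1%:R * psum (taylor_shift a m.+1) (t - t0))).
    rewrite /D /derive1n iterS -/(derive1n m f) derive1E (@derive_val _ _ _ _ _ _ _ H).
    by rewrite mulrA -natrM mulnC -factS mulKf.
  have H : is_derive t (1 : R) (fun y => m`!%:R * psum (taylor_shift a m) (y - t0))
      (m`!%:R * (m.+1%:R * psum (taylor_shift a m.+1) (t - t0))).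
    apply: is_derive_scale.
    apply: (is_derive_eq (is_derive1_comp _ (is_derive_shift t 1 (- t0)))).
      exact: is_derive_psum_shift s0 ga ts.
    by rewrite mulr1.
  apply: near_eq_is_derive H.
  apply/nbhs_ballP; exists ((16 * s)^-1 - `|t - t0|); first by rewrite /= subr_gt0.
  move=> y; rewrite /ball /= distrC => yt.
  rewrite -IH ?/D ?mulVKf //.
  by have := ler_normD (y - t) (t - t0); rewrite addrA subrK; lra.
have D0 : D 0%N = f by apply/funext => t; rewrite /D fact0 invr1 mul1r.
split=> //.
- move=> m x; have [M [s [a [M1 s1 ga DE]]]] := loc x.
  have s0 : 0 < s by lra.
  have s16 : 0 < (16 * s)^-1 by rewrite invr_gt0; lra.
  rewrite DE ?subrr ?normr0 //.
  have H : is_derive x (1 : R) (fun y => psum (taylor_shift a m) (y - x))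
      (m.+1%:R * psum (taylor_shift a m.+1) 0).
    apply: (is_derive_eq (is_derive1_comp _ (is_derive_shift x 1 (- x)))).
      by apply: is_derive_psum_shift s0 ga _; rewrite /= subrr normr0.
    by rewrite mulr1 /= subrr.
  apply: near_eq_is_derive H.
  apply/nbhs_ballP; exists ((16 * s)^-1) => // y; rewrite /ball /= distrC => yx.
  by rewrite DE.
- move=> x; have [M [s [a [M1 s1 ga DE]]]] := loc x.
  have Ms : s <= M * s by rewrite ler_peMl //; lra.
  have MM : M <= M * s by rewrite ler_peMr //; lra.
  exists (16 * (M * s)); split; first by lra.
  move=> y m yx.
  have ys : `|y - x| < (16 * s)^-1.
    by apply: lt_le_trans yx _; rewrite lef_pV2 ?posrE; lra.
  have s0 : 0 < s by lra.
  have ys2 : 2 * s * `|y - x| <= 1 / 2.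
    have : 16 * s * `|y - x| < 1 by rewrite mulrC -ltr_pdivlMr ?mul1r //; lra.
    by have := normr_ge0 (y - x); nra.
  rewrite DE //.
  have s20 : 0 <= 2 * s by lra.
  have lt1 : 2 * s * `|y - x| < 1 by lra.
  have gm := geom_bound_shift a M s m (ltW s0) ga.
  have [_] := geom_bound_series _ _ _ _ s20 gm lt1.
  have B0 : 0 <= M * (2 * s) ^+ m by rewrite mulr_ge0 ?exprn_ge0 //; lra.
  move/le_trans; apply.
  apply: (@le_trans _ _ (2 * (M * (2 * s) ^+ m))).
    rewrite ler_pdivrMr; last lra.
    rewrite -subr_ge0; have -> : forall b u : R, 2 * b * (1 - u) - b = b * (1 - 2 * u).
      by move=> b u; ring.
    by rewrite mulr_ge0 //; lra.
  rewrite exprS mulrA; apply: ler_pM; rewrite ?exprn_ge0 //; [lra|lra|].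
  by apply: lerXn2r; rewrite ?nnegrE; lra.
Qed.

End PowerSeries.

(** * Leading terms and sampling of analytic functions *)

Section Analytic.
Context {R : realType}.
Implicit Types (f g : R -> R) (D E : nat -> R -> R) (a x C : R).

Lemma jets_mulc f D a : jets f D ->
  jets (fun x => a * f x) (fun m x => a * D m x).
Proof.
move=> [<- dD BD]; split=> //.
- by move=> m x; rewrite mulrCA; exact: is_derive_scale.
- move=> x; have [C [C1 HD]] := BD x.
  have a1 : 1 <= 1 + `|a| by rewrite lerDl.
  have Ca : C <= (1 + `|a|) * C by rewrite ler_peMl //; lra.
  exists ((1 + `|a|) * C); split=> [|y m yx]; first lra.
  have yC : `|y - x| < C^-1.
    by apply: lt_le_trans yx _; rewrite lef_pV2 ?posrE; lra.
  rewrite normrM exprMn; apply: ler_pM => //; last exact: HD.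
  rewrite exprS; apply: (@le_trans _ _ (1 + `|a|)); first by rewrite lerDr.
  by rewrite ler_peMr ?exprn_ege1 //; lra.
Qed.

Lemma jets_sum (I : Type) (r : seq I) (F : I -> R -> R)
    (DF : I -> nat -> R -> R) : (forall i, jets (F i) (DF i)) ->
  jets (fun x => \sum_(i <- r) F i x) (fun m x => \sum_(i <- r) DF i m x).
Proof.
move=> H; elim: r => [|i r IH].
  have -> : (fun x => \sum_(i <- [::]) F i x) = (fun=> 0).
    by apply/funext => x; rewrite big_nil.
  have -> : (fun m x => \sum_(i <- [::]) DF i m x) =
      (fun m _ => if m is 0%N then 0 else 0).
    by apply/funext => m; apply/funext => x; rewrite big_nil; case: m.
  exact: jets_cst.
have -> : (fun x => \sum_(i <- i :: r) F i x) =
    (fun x => F i x + \sum_(i <- r) F i x).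
  by apply/funext => x; rewrite big_cons.
have -> : (fun m x => \sum_(i <- i :: r) DF i m x) =
    (fun m x => DF i m x + \sum_(i <- r) DF i m x).
  by apply/funext => m; apply/funext => x; rewrite big_cons.
exact: jets_add.
Qed.

Definition analytic f := exists D, jets f D.

Lemma analytic_continuous f : analytic f -> continuous f.
Proof. by move=> [D fD]; have [<- _ _] := fD; exact: jets_continuous fD. Qed.

Lemma analytic_derivable f x : analytic f -> derivable f x 1.
Proof. by move=> [D [<- dD _]]; case: (dD 0%N x). Qed.

Lemma analytic_cst a : analytic (fun=> a).
Proof. by eexists; exact: jets_cst. Qed.

Lemma analytic_add f g : analytic f -> analytic g ->
  analytic (fun x => f x + g x).
Proof. by move=> [D fD] [E gE]; eexists; exact: jets_add fD gE. Qed.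

Lemma analytic_mul f g : analytic f -> analytic g ->
  analytic (fun x => f x * g x).
Proof. by move=> [D fD] [E gE]; eexists; exact: jets_mul fD gE. Qed.

Lemma analytic_sum (I : Type) (r : seq I) (F : I -> R -> R) :
  (forall i, analytic (F i)) -> analytic (fun x => \sum_(i <- r) F i x).
Proof.
move=> H; elim: r => [|i r IH].
  under eq_fun do rewrite big_nil; exact: analytic_cst.
under eq_fun do rewrite big_cons; exact: analytic_add.
Qed.

Lemma analytic_prod (I : Type) (r : seq I) (F : I -> R -> R) :
  (forall i, analytic (F i)) -> analytic (fun x => \prod_(i <- r) F i x).
Proof.
move=> H; elim: r => [|i r IH].
  under eq_fun do rewrite big_nil; exact: analytic_cst.
under eq_fun do rewrite big_cons; exact: analytic_mul.
Qed.

Lemma analytic_mulmx m n p (M : R -> 'M[R]_(m, n)) (M' : R -> 'M[R]_(n, p)) :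
  (forall i j, analytic (fun x => M x i j)) ->
  (forall i j, analytic (fun x => M' x i j)) ->
  forall i j, analytic (fun x => (M x *m M' x) i j).
Proof.
move=> H H' i j; under eq_fun do rewrite mxE.
by apply: analytic_sum => l; exact: analytic_mul.
Qed.

Lemma analytic_det n (M : R -> 'M[R]_n) :
  (forall i j, analytic (fun x => M x i j)) -> analytic (fun x => \det (M x)).
Proof.
move=> H; apply: analytic_sum => s.
by apply: analytic_mul; [exact: analytic_cst|exact: analytic_prod].
Qed.

(** [a] may be zero, so that the terms of a sum, or all entries of a matrix, can share one order
    [p]. *)
Definition leading f p a :=
  exists2 D, jets f D & (forall m, (m < p)%N -> D m 0 = 0) /\ D p 0 = a.

Lemma leading_add f g p a b : leading f p a -> leading g p b ->
  leading (fun x => f x + g x) p (a + b).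
Proof.
move=> [D fD [D0 Da]] [E gE [E0 Eb]].
eexists; first exact: jets_add fD gE.
by split=> [m mp|]; rewrite ?Da ?Eb // D0 ?E0 ?addr0.
Qed.

Lemma leading_mul f g p q a b : leading f p a -> leading g q b ->
  leading (fun x => f x * g x) (p + q) (a * b).
Proof.
move=> [D fD [D0 Da]] [E gE [E0 Eb]].
eexists; first exact: jets_mul fD gE.
split=> [m mp|].
  apply: big1 => i _; have [ip|ip] := ltnP i p; first by rewrite D0 ?mul0r.
  by rewrite E0 ?mulr0 //; have := ltn_ord i; lia.
have pq : (p < (p + q).+1)%N by lia.
rewrite /conv (bigD1 (Ordinal pq)) //= addKn Da Eb big1 ?addr0 // => i ip.
have [ltip|ip'] := ltnP i p; first by rewrite D0 ?mul0r.
rewrite E0 ?mulr0 //; have := ltn_ord i.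
have : (i : nat) <> p by move=> /esym E'; move/eqP: ip; apply; exact: val_inj.
lia.
Qed.

Lemma leading_cst a : leading (fun=> a) 0 a.
Proof. by eexists; [exact: jets_cst|]. Qed.

Lemma leading0 p : leading (fun=> 0) p 0.
Proof. by eexists; [exact: jets_cst|split=> [[|m]|]//; case: p]. Qed.

Lemma leading_id : leading id 1 1.
Proof. by eexists; [exact: jets_id|split=> [[|m]|]]. Qed.

Lemma leading_exp q : leading (fun x => x ^+ q) q 1.
Proof.
elim: q => [|q IH]; first by under eq_fun do rewrite expr0; exact: leading_cst.
under eq_fun do rewrite exprS.
by rewrite -[1]mulr1; exact: (leading_mul _ _ 1 q _ _ leading_id IH).
Qed.

Lemma leading_sum (I : Type) (r : seq I) (F : I -> R -> R) p (a : I -> R) :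
  (forall i, leading (F i) p (a i)) ->
  leading (fun x => \sum_(i <- r) F i x) p (\sum_(i <- r) a i).
Proof.
move=> H; elim: r => [|i r IH].
  under eq_fun do rewrite big_nil; rewrite big_nil; exact: leading0.
by under eq_fun do rewrite big_cons; rewrite big_cons; exact: leading_add.
Qed.

Lemma leading_prod (I : Type) (r : seq I) (F : I -> R -> R) p (a : I -> R) :
  (forall i, leading (F i) p (a i)) ->
  leading (fun x => \prod_(i <- r) F i x) (size r * p) (\prod_(i <- r) a i).
Proof.
move=> H; elim: r => [|i r IH].
  under eq_fun do rewrite big_nil; rewrite big_nil; exact: leading_cst.
under eq_fun do rewrite big_cons; rewrite big_cons mulSn.
exact: leading_mul.
Qed.

(** Every permutation contributes a product of the same total order, so the leading coefficients
    assemble to [\det A]. *)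
Lemma leading_det n (M : R -> 'M[R]_n) p (A : 'M[R]_n) :
  (forall i j, leading (fun x => M x i j) p (A i j)) ->
  exists q, leading (fun x => \det (M x)) q (\det A).
Proof.
move=> H; exists (0 + size (index_enum 'I_n) * p)%N.
apply: (leading_sum _ _ (fun (s : 'S_n) x => (-1) ^+ s * \prod_i M x i (s i)) _
  (fun s : 'S_n => (-1) ^+ s * \prod_i A i (s i))) => s.
apply: leading_mul; first exact: leading_cst.
exact: (leading_prod _ _ (fun i x => M x i (s i)) _ (fun i => A i (s i))).
Qed.

Lemma leading_countable_zeros f p a : leading f p a -> a != 0 ->
  countable_R [set x | f x = 0].
Proof.
move=> [D fD [_ Da]] a0; apply: (countable_zeros f D fD).
apply: contrapT => N; have f0 x : f x = 0.
  by apply/eqP/negPn/negP => fx; apply: N; exists x.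
have [D0 dD _] := fD.
have Dz m x : D m x = 0.
  elim: m x => [|m IH] x; first by rewrite D0.
  have : m.+1%:R * D m.+1 x = 0.
    apply: (is_derive_uniq _ _ _ _ (dD m x)).
    have -> : D m = cst 0 by apply/funext.
    exact: is_derive_cst.
  by move/eqP; rewrite mulf_eq0 pnatr_eq0 /= => /eqP.
by move: a0; rewrite -Da Dz eqxx.
Qed.

(** * Sampling of linearly independent analytic functions *)

Section Sampling.
Variables (N : nat) (f : 'I_N -> R -> R).
Hypothesis f_free : forall w : 'rV[R]_N,
  (forall t, \sum_i w 0 i * f i t = 0) -> w = 0.

(** While the rank is below [N], a kernel vector [w] gives a nonzero combination of the [f i], which
    by the identity theorem has a nonzero coefficient; adding its column removes [w] from the kernel
    and raises the rank. *)
Lemma jet_matrix_row_free (D : 'I_N -> nat -> R -> R) :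
  (forall i, jets (f i) (D i)) ->
  exists L, row_free (\matrix_(i < N, m < L) D i m 0).
Proof.
move=> fD; pose M L : 'M[R]_(N, L) := \matrix_(i < N, m < L) D i m 0.
have rk r : (r <= N)%N -> exists L, (r <= \rank (M L))%N.
  elim: r => [|r IH] rN; first by exists 0%N.
  have [L rL] := IH (ltnW rN).
  move: rL; rewrite leq_eqVlt => /orP[/eqP rL|]; last by exists L.
  have /rowV0Pn[w wL w0] : kermx (M L) != 0.
    by rewrite -mxrank_eq0 mxrank_ker -rL subn_eq0 -ltnNge.
  have [m wm] : exists m, \sum_i w 0 i * D i m 0 != 0.
    apply: contrapT => Nm; case/eqP: w0; apply: f_free.
    have jE : jets (fun t => \sum_i w 0 i * f i t)
        (fun m t => \sum_i w 0 i * D i m t).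
      by apply: (jets_sum _ _ (fun i t => w 0 i * f i t)
        (fun i m t => w 0 i * D i m t)) => i; exact: jets_mulc.
    apply: (jets_eq0 _ _ 0 jE) => m; apply/eqP/negPn/negP => Em.
    by apply: Nm; exists m.
  pose L' := maxn L m.+1; exists L'.
  have : (kermx (M L') < kermx (M L))%MS.
    apply/andP; split.
      apply/sub_kermxP/matrixP => i l; rewrite [RHS]mxE.
      have lL' : (l < L')%N by rewrite leq_max ltn_ord.
      have := congr1 (fun A : 'M[R]_(_, _) => A i (Ordinal lL')) (mulmx_ker (M L')).
      by rewrite [in RHS]mxE => <-; rewrite !mxE; apply: eq_bigr => q _; rewrite !mxE.
    apply/negP => sub; have /sub_kermxP := submx_trans wL sub.
    have mL' : (m < L')%N by rewrite leq_max ltnSn orbT.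
    move/matrixP/(_ 0 (Ordinal mL')); rewrite !mxE => E.
    by case/eqP: wm; rewrite -[RHS]E; apply: eq_bigr => i _; rewrite mxE.
  move/rank_ltmx; rewrite !mxrank_ker -rL.
  by have := rank_leq_row (M L'); lia.
have [L rL] := rk N (leqnn N).
by exists L; rewrite /row_free eqn_leq rank_leq_row rL.
Qed.

(** A [w] that annihilates the samples lies in the left kernel of [G d], whose entries are
    combinations of samples. The determinant of [G] has leading coefficient 1, hence countably many
    zeros. [L] comes from the jets at 0 and does not depend on [k]. *)
Lemma sampled_span : (forall i, analytic (f i)) ->
  exists L, forall k : int, countable_R [set d | exists2 w : 'rV[R]_N, w != 0 &
    forall j : nat, (j < L)%N -> \sum_i w 0 i * f i ((k + j%:Z)%:~R * d) = 0].
Proof.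
move=> /choice[D fD].
have [L /row_freeP[B MB]] := jet_matrix_row_free D fD; exists L => k.
pose pt (j : nat) : R := (k + j%:Z)%:~R.
(* The nodes [k + j] are distinct; column [m] of the inverse [W] isolates the power [m] among those
   below [L]. *)
pose V : 'M[R]_L := Vandermonde L (\row_j pt j).
have Vu : V \in unitmx.
  rewrite unitmxE det_Vandermonde unitfE; apply/prodf_neq0 => i _.
  apply/prodf_neq0 => j ij; rewrite !mxE subr_eq0 eqr_int.
  by apply/eqP => /addrI [] E; move: ij; rewrite E ltnn.
pose W := invmx V; have VW : V *m W = 1%:M by exact: mulmxV.
pose phi i m x := \sum_(j < L) W j m * f i (pt j * x).
have phi_lead i (m : 'I_L) : leading (phi i m) m (D i m 0).
  pose E q x := \sum_(j < L) W j m * (pt j ^+ q * D i q (pt j * x)).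
  have jE : jets (phi i m) E.
    apply: (jets_sum _ _ (fun j x => W j m * f i (pt j * x))
      (fun j q x => W j m * (pt j ^+ q * D i q (pt j * x)))) => j.
    by apply: jets_mulc; exact: jets_scale.
  have E0 (q : 'I_L) : E q 0 = (q == m)%:R * D i q 0.
    rewrite /E; under eq_bigr do rewrite mulr0 mulrA.
    rewrite -mulr_suml; congr (_ * _).
    have := congr1 (fun A : 'M[R]_(_, _) => A q m) VW; rewrite !mxE => <-.
    by apply: eq_bigr => j _; rewrite !mxE mulrC.
  exists E => //; split; last by rewrite E0 eqxx mul1r.
  move=> q qm; have qL := ltn_trans qm (ltn_ord m).
  by rewrite (E0 (Ordinal qL)) -val_eqE /= ltn_eqF ?mul0r.
(* The factor [x ^+ (L - m)] brings all summands to order [L]; the leading matrix is the jet matrix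
   times its right inverse [B]. *)
pose G x : 'M[R]_N :=
  \matrix_(i, i') \sum_(m < L) phi i m x * (x ^+ (L - m) * B m i').
have [q Gq] : exists q, leading (fun x => \det (G x)) q (\det (1%:M : 'M[R]_N)).
  apply: (leading_det _ _ L) => i i'.
  rewrite -MB mxE; under eq_fun do rewrite mxE.
  apply: (leading_sum _ _ (fun m x => _) _ (fun m => _)) => m.
  rewrite mxE -[L in leading _ L](subnKC (ltnW (ltn_ord m))).
  apply: leading_mul (phi_lead i m) _.
  have := leading_mul _ _ _ _ _ _ (leading_exp (L - m)) (leading_cst (B m i')).
  by rewrite addn0 mul1r.
apply: countable_R_sub (leading_countable_zeros _ _ _ Gq _); last first.
  by rewrite det1 oner_neq0.
move=> d [w w0 wd] /=; apply/eqP/det0P; exists w => //.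
apply/rowP => i'; rewrite !mxE.
under eq_bigr do rewrite mxE mulr_sumr.
rewrite exchange_big big1 //= => m _.
under eq_bigr do rewrite mulrA.
rewrite -mulr_suml /phi.
under eq_bigr do rewrite mulr_sumr.
rewrite exchange_big big1 ?mul0r //= => j _.
under eq_bigr do rewrite mulrCA.
by rewrite -mulr_sumr wd ?mulr0.
Qed.

End Sampling.
End Analytic.

(** * Linear differential equations and primitives *)

Section ODE.
Context {R : realType}.
Implicit Types (f g : R -> R) (D E : nat -> R -> R) (a x C : R).

Lemma jet_bound_finite (T : finType) (D : T -> nat -> R -> R) x :
  (forall i, exists C, jet_bound (D i) x C) ->
  exists C, 1 <= C /\ forall i, jet_bound (D i) x C.
Proof.
move=> /choice[C HC]; exists (1 + \sum_i C i).
have C0 i : 0 <= C i by case: (HC i) => ? _; lra.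
split=> [|i]; first by rewrite lerDl sumr_ge0.
apply: (jet_bound_le _ _ (C i)) (HC i).
by rewrite (bigD1 i) //= addrCA lerDl addr_ge0 // sumr_ge0.
Qed.

Lemma continuous_bounded_near f x : continuous f ->
  exists C, 1 <= C /\ forall y, `|y - x| < C^-1 -> `|f y| <= C.
Proof.
move=> cf; have /cvgrPdist_lt/(_ _ ltr01) := cf x.
move=> /nbhs_ballP[e /= e0 He].
exists (1 + `|f x| + 1 + e^-1); split=> [|y yx].
  by have := normr_ge0 (f x); have : 0 < e^-1 by [rewrite invr_gt0]; lra.
have ei0 : 0 < e^-1 by rewrite invr_gt0.
have fx0 := normr_ge0 (f x).
have : `|f x - f y| < 1.
  apply: He; rewrite /ball /= distrC; apply: lt_le_trans yx _.
  by rewrite -[X in _ <= X]invrK lef_pV2 ?posrE; lra.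
by have := ler_normD (f x) (f y - f x); rewrite addrC subrK distrC; lra.
Qed.

Lemma is_derive_conv D E m x :
  (forall q, (q <= m)%N -> is_derive x (1 : R) (D q) (q.+1%:R * D q.+1 x)) ->
  (forall q, (q <= m)%N -> is_derive x (1 : R) (E q) (q.+1%:R * E q.+1 x)) ->
  is_derive x (1 : R) (conv D E m) (m.+1%:R * conv D E m.+1 x).
Proof.
move=> dD dE.
apply: (is_derive_eq _ (conv_derive (fun i => D i x) (fun i => E i x) m)).
apply: (is_derive_bigsum _ _ (fun (i : 'I_m.+1) y => D i y * E (m - i)%N y)
  (fun (i : 'I_m.+1) y => i.+1%:R * D i.+1 y * E (m - i)%N y +
      D i y * ((m - i).+1%:R * E (m - i).+1 y)) x) => i.
by apply: is_derive_mul; [apply: dD; rewrite -ltnS|apply: dE; exact: leq_subr].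
Qed.

Section LinearODE.
Variables (n : nat) (A : 'I_n -> 'I_n -> R -> R) (AD : 'I_n -> 'I_n -> nat -> R -> R).
Hypothesis A_jets : forall i j, jets (A i j) (AD i j).
Variable (X : 'I_n -> R -> R).
Hypothesis X_ode : forall i t,
  is_derive t (1 : R) (X i) (\sum_j A i j t * X j t).

(** Taylor coefficients forced by the equation. Each one depends on all earlier ones, so a table up
    to order [k] is built by structural recursion, and [ode_jet] reads its diagonal. *)
Fixpoint ode_prefix (k : nat) : 'I_n -> nat -> R -> R :=
  if k is k'.+1 then fun i m t =>
    if (m <= k')%N then ode_prefix k' i m t
    else (k'.+1%:R)^-1 * \sum_l conv (AD i l) (ode_prefix k' l) k' t
  else fun i _ => X i.

Definition ode_jet i m := ode_prefix m i m.

Lemma ode_prefixE k i m : (m <= k)%N -> ode_prefix k i m = ode_jet i m.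
Proof.
elim: k => [|k IH]; first by rewrite leqn0 => /eqP ->.
rewrite leq_eqVlt => /orP[/eqP -> //|]; rewrite ltnS => mk.
by apply/funext => t; rewrite /= mk IH.
Qed.

Lemma ode_jetS i m t :
  ode_jet i m.+1 t = (m.+1%:R)^-1 * \sum_l conv (AD i l) (ode_jet l) m t.
Proof.
rewrite /ode_jet /= ltnn; congr (_ * _); apply: eq_bigr => l _.
by apply: eq_bigr => q _; rewrite ode_prefixE ?leq_subr.
Qed.

Lemma ode_jet0 i : ode_jet i 0 = X i.
Proof. by []. Qed.

Opaque ode_jet.

Lemma ode_jets i : jets (X i) (ode_jet i).
Proof.
split; first exact: ode_jet0.
- move=> m; elim/ltn_ind: m i => -[|m] IH i t.
    rewrite ode_jet0 mul1r ode_jetS invr1 mul1r.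
    apply: (is_derive_eq (X_ode i t)); apply: eq_bigr => l _.
    by rewrite /conv big_ord1 ode_jet0; have [-> _ _] := A_jets i l.
  have -> : ode_jet i m.+1 =
      (fun t => (m.+1%:R)^-1 * \sum_l conv (AD i l) (ode_jet l) m t).
    by apply/funext => s; exact: ode_jetS.
  have -> : m.+2%:R * ode_jet i m.+2 t =
     (m.+1%:R)^-1 * \sum_l m.+1%:R * conv (AD i l) (ode_jet l) m.+1 t.
    by rewrite ode_jetS mulVKf ?pnatr_eq0 // -mulr_sumr mulKf ?pnatr_eq0.
  apply: is_derive_scale.
  apply: (is_derive_bigsum _ _ (fun l t => conv (AD i l) (ode_jet l) m t)
    (fun l t => m.+1%:R * conv (AD i l) (ode_jet l) m.+1 t)) => l.
  apply: (is_derive_conv (AD i l) (ode_jet l)) => q qm; last exact: (IH q qm l t).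
  by have [_ dA _] := A_jets i l.
- move=> x.
  have [CA [CA1 HA]] : exists C, 1 <= C /\ forall p : 'I_n * 'I_n, jet_bound (AD p.1 p.2) x C.
    by apply: jet_bound_finite => p; have [_ _] := A_jets p.1 p.2; apply.
  have Xb j : exists C, 1 <= C /\ forall y, `|y - x| < C^-1 -> `|X j y| <= C.
    apply: continuous_bounded_near => t.
    by apply/differentiable_continuous/derivable1_diffP; case: (X_ode j t).
  have [CX HX] := choice Xb.
  have CX0 j : 0 <= CX j by case: (HX j) => ? _; lra.
  have sCX : 0 <= \sum_j CX j by apply: sumr_ge0.
  have nCA : 0 <= n%:R * CA by rewrite mulr_ge0 //; lra.
  (* The recursion multiplies the bound by at most [n%:R * CA]; the other summands cover the
     coefficients of [A] and the values of [X]. *)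
  pose C := n%:R * CA + CA + \sum_j CX j.
  have C1 : 1 <= C by rewrite /C; lra.
  have C0 : 0 < C by lra.
  have nC : n%:R * CA <= C by rewrite /C; lra.
  have CAC : CA <= C by rewrite /C; lra.
  exists C; split=> // y m yx.
  have HAC j l q : `|AD j l q y| <= CA * C ^+ q.
    have [_ /(_ y q)] := HA (j, l); rewrite exprS => H; apply: le_trans (H _) _.
      by apply: lt_le_trans yx _; rewrite lef_pV2 ?posrE; lra.
    rewrite ler_wpM2l //; first lra.
    by apply: lerXn2r; rewrite ?nnegrE; lra.
  elim/ltn_ind: m i => -[|m] IH i.
    rewrite ode_jet0 expr1; have [C1' HXi] := HX i.
    have CXC : CX i <= C.
      by rewrite /C (bigD1 i) //= addrCA lerDl addr_ge0 ?addr_ge0 ?sumr_ge0 //; lra.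
    apply: (le_trans _ CXC); apply: HXi; apply: lt_le_trans yx _.
    by rewrite lef_pV2 ?posrE //; lra.
  rewrite ode_jetS normrM normfV normr_nat ler_pdivrMl //.
  apply: le_trans (ler_norm_sum _ _ _) _.
  apply: (@le_trans _ _ (\sum_(l < n) \sum_(q < m.+1) CA * C ^+ m.+1)).
    apply: ler_sum => l _; apply: le_trans (ler_norm_sum _ _ _) _.
    apply: ler_sum => q _; rewrite normrM.
    have -> : CA * C ^+ m.+1 = CA * C ^+ q * C ^+ (m - q).+1.
      by rewrite -mulrA -exprD; congr (_ * _ ^+ _); have := ltn_ord q; lia.
    by apply: ler_pM => //; apply: IH; rewrite ltnS leq_subr.
  rewrite !sumr_const !card_ord.
  have -> : CA * C ^+ m.+1 *+ m.+1 *+ n = m.+1%:R * (n%:R * CA * C ^+ m.+1).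
    by rewrite -[_ *+ n]mulr_natl -[_ *+ m.+1]mulr_natl; ring.
  rewrite ler_wpM2l // [X in _ <= X]exprS ler_wpM2r // exprn_ge0 //; lra.
Qed.

Lemma ode_jet_zero t : (forall i, X i t = 0) -> forall m i, ode_jet i m t = 0.
Proof.
move=> X0 m; elim/ltn_ind: m => -[|m] IH i; first by rewrite ode_jet0.
rewrite ode_jetS big1 ?mulr0 // => l _; apply: big1 => q _.
by rewrite IH ?mulr0 // ltnS leq_subr.
Qed.

(** Uniqueness through analyticity: the recursion makes all coefficients at [s] vanish. *)
Lemma ode_zero s : (forall i, X i s = 0) -> forall i t, X i t = 0.
Proof.
move=> X0 i; apply: (jets_eq0 _ _ s (ode_jets i)) => m.
exact: ode_jet_zero.
Qed.

End LinearODE.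

Lemma primitive_analytic f B : analytic f ->
  (forall x, is_derive x (1 : R) B (f x)) -> analytic B.
Proof.
move=> [D [D0 dD BD]] dB.
exists (fun m => if m is m'.+1 then fun x => (m'.+1%:R)^-1 * D m' x else B).
split=> //.
- move=> [|m] x; first by rewrite mul1r invr1 mul1r D0.
  rewrite mulVKf ?pnatr_eq0 //.
  apply: (is_derive_eq (is_derive_scale _ (m.+1%:R)^-1 _ _ (dD m x))).
  by rewrite mulKf ?pnatr_eq0.
- move=> x; have [C [C1 HD]] := BD x.
  have cB : continuous B.
    by move=> t; apply/differentiable_continuous/derivable1_diffP; case: (dB t).
  have [C' [C'1 HB]] := continuous_bounded_near B x cB.
  exists (C + C'); split=> [|y [|m] yx]; first lra.
    rewrite expr1; apply: (@le_trans _ _ C'); last lra.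
    by apply: HB; apply: lt_le_trans yx _; rewrite lef_pV2 ?posrE; lra.
  apply: (@le_trans _ _ `|D m y|).
    rewrite normrM normfV normr_nat ler_pdivrMl // ler_peMl // ler1n //.
  have yC : `|y - x| < C^-1.
    by apply: lt_le_trans yx _; rewrite lef_pV2 ?posrE; lra.
  apply: le_trans (HD y m yC) _.
  apply: (@le_trans _ _ (C ^+ m.+2)); first by rewrite ler_weXn2l.
  by apply: lerXn2r; rewrite ?nnegrE; lra.
Qed.

Lemma segment_integrable f (a b : R) : continuous f ->
  (@lebesgue_measure R).-integrable `[a, b] (EFin \o f).
Proof.
move=> cf; apply: continuous_compact_integrable; first exact: segment_compact.
exact: continuous_subspaceT.
Qed.

Lemma continuous_primitive f : continuous f ->
  exists B, forall x, is_derive x (1 : R) B (f x).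
Proof.
move=> cf; pose mu := @lebesgue_measure R.
(* The signed integral from 0. For [y > - N] it is an integral from [- N] minus a constant, to which
   the fundamental theorem applies. *)
pose B t := \int[mu]_(s in `]0, t]) f s - \int[mu]_(s in `]t, 0]) f s.
exists B => x.
have BE N y : 0 < N -> - N < y ->
    B y = \int[mu]_(s in `[- N, y]) f s - \int[mu]_(s in `[- N, 0]) f s.
  move=> N0 Ny; rewrite /B; have [y0|y0] := leP 0 y.
    rewrite [X in _ - X](_ : _ = 0); last first.
      by rewrite set_itv_ge ?Rintegral_set0 // bnd_simp -leNgt.
    rewrite subr0 Rintegral_itvB //; [exact: segment_integrable|rewrite bnd_simp; lra].
  rewrite [X in X - _](_ : _ = 0); last first.
    by rewrite set_itv_ge ?Rintegral_set0 // bnd_simp -leNgt ltW.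
  rewrite sub0r -opprB; congr (- _); rewrite Rintegral_itvB //.
  - exact: segment_integrable.
  - by rewrite bnd_simp; lra.
  - by rewrite bnd_simp; lra.
pose N := `|x| + 1.
have N0 : 0 < N by rewrite ltr_wpDl.
have Nx : - N < x by rewrite /N; have := ler_norm (- x); rewrite normrN; lra.
have [dF Fx] := @continuous_FTC1_closed R f (- N) x (x + 1) ltac:(by rewrite ltrDl)
  (segment_integrable f _ _ cf) Nx (cf x).
have H : is_derive x (1 : R) (fun y => \int[mu]_(s in `[- N, y]) f s -
   \int[mu]_(s in `[- N, 0]) f s) (f x).
  apply: (is_derive_eq (is_derive_add _ _ _ _ _ _ (is_derive_cst _ _ _))); last exact: addr0.
  by split=> //; rewrite -derive1E.
apply: near_eq_is_derive H.
apply/nbhs_ballP; exists (x + N); first by rewrite /=; lra.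
move=> y; rewrite /ball /= => xy; rewrite (BE N) //.
by have := ler_norm (x - y); lra.
Qed.

Lemma integral_primitive f B (a b : R) : continuous f ->
  (forall x, is_derive x (1 : R) B (f x)) -> a < b ->
  \int[@lebesgue_measure R]_(s in `[a, b]) f s = B b - B a.
Proof.
move=> cf dB ab.
have cB : continuous B.
  by move=> t; apply/differentiable_continuous/derivable1_diffP; case: (dB t).
rewrite /Rintegral (@continuous_FTC2 R f B a b) //.
- exact: continuous_subspaceT.
- split; first by move=> t _; case: (dB t).
  + exact/cvg_at_right_filter/cB.
  + exact/cvg_at_left_filter/cB.
- by move=> t _; rewrite derive1E; case: (dB t).
Qed.

End ODE.

(** * The sampled system *)

Section Assembly.
Context {R : realType}.

(** Used to perturb [c] in the density argument, which must remain within [analytic_mx]. *)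
Lemma real_analytic_addc (f : R -> R) (a : R) : real_analytic f ->
  real_analytic (fun t => f t + a).
Proof.
move=> af t0; have [r r0 [u Hu]] := af t0; exists r => //.
exists (fun k => u k + (if k is 0%N then a else 0)) => t tr.
(* The empty partial sum lacks the constant, which enters from [N = 1] on. *)
have -> : (fun N : nat => \sum_(k < N) (u k + (if (k : nat) is 0%N then a else 0)) * (t - t0) ^+ k)
  = (fun N : nat => \sum_(k < N) u k * (t - t0) ^+ k +
      (if N is 0%N then 0 else a)).
  apply/funext => -[|N]; first by rewrite !big_ord0 addr0.
  under eq_bigr do rewrite mulrDl.
  rewrite big_split /=; congr (_ + _).
  rewrite big_ord_recl expr0 mulr1 big1 ?addr0 // => i _.
  by rewrite lift0 mul0r.
apply: cvgD; first exact: Hu.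
by apply: cvg_near_cst; exists 1%N => // -[].
Qed.

Section System.
Variables (n : nat) (A : R -> 'M[R]_n) (b : R -> 'cV[R]_n) (Phi : R -> R -> 'M[R]_n).
Hypothesis A_an : analytic_mx A.
Hypothesis b_an : analytic_mx b.
Hypothesis Phi_tr : transition_matrix A Phi.

(** Both sides solve the same equation in [t] and agree at [t = s]. *)
Lemma transition_comp t s r : Phi t s *m Phi s r = Phi t r.
Proof.
have [Phi1 dPhi] := Phi_tr.
have [AD AJ] : exists AD : 'I_n -> 'I_n -> nat -> R -> R,
    forall i j, jets (fun t => A t i j) (AD i j).
  have [AD HAD] := choice (fun p : 'I_n * 'I_n => real_analytic_jets _ (A_an p.1 p.2)).
  by exists (fun i j => AD (i, j)) => i j; exact: (HAD (i, j)).
apply/matrixP => i j; apply/eqP; rewrite -subr_eq0; apply/eqP.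
pose X i t := (Phi t s *m Phi s r) i j - Phi t r i j.
apply: (ode_zero n (fun i j t => A t i j) AD AJ X _ s) => [k u|k]; last first.
  by rewrite /X Phi1 mul1mx subrr.
have -> : \sum_l A u k l * X l u = (A u *m Phi u s *m Phi s r) k j - (A u *m Phi u r) k j.
  rewrite -mulmxA ![(A u *m _) k j]mxE -sumrB.
  by apply: eq_bigr => l _; rewrite /X mulrBr.
apply: (@is_deriveB _ _ _ (fun y => (Phi y s *m Phi s r) k j)
  (fun y => Phi y r k j)).
under eq_fun do rewrite mxE; rewrite mxE.
apply: (is_derive_bigsum _ _ (fun l y => Phi y s k l * Phi s r l j)
  (fun l y => (A y *m Phi y s) k l * Phi s r l j)) => l.
under eq_fun do rewrite mulrC; rewrite mulrC.
exact: is_derive_scale.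
Qed.

Let Y t := Phi t 0.
Let Z t := Phi 0 t.

Lemma transition_invl t : Z t *m Y t = 1%:M.
Proof. by rewrite transition_comp; case: Phi_tr. Qed.

Lemma transition_invr t : Y t *m Z t = 1%:M.
Proof. by rewrite transition_comp; case: Phi_tr. Qed.

Lemma transition_analytic i j : analytic (fun t => Y t i j).
Proof.
have [Phi1 dPhi] := Phi_tr.
have [AD HAD] := choice (fun p : 'I_n * 'I_n => real_analytic_jets _ (A_an p.1 p.2)).
eexists; apply: (ode_jets n (fun i j t => A t i j) (fun i j => AD (i, j)) _
  (fun i t => Y t i j)) => [k l|k t]; first exact: (HAD (k, l)).
by have := dPhi t 0 k j; rewrite mxE.
Qed.

(** [transition_matrix] speaks of derivatives in the first argument only; for the second one, [Z] is
    written as the inverse of [Y] by Cramer's rule. *)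
Lemma transition_inv_derivable i j t : derivable (fun t => Z t i j) t 1.
Proof.
have Yu s : Y s \in unitmx by have [] := mulmx1_unit (transition_invr s).
have -> : (fun t => Z t i j) = (fun t => (\det (Y t))^-1 * cofactor (Y t) j i).
  apply/funext => s.
  have -> : Z s = invmx (Y s) by rewrite -[RHS]mul1mx -(transition_invl s) mulmxK.
  by rewrite /invmx Yu !mxE.
apply: derivableM.
  apply: derivableV.
    by rewrite -unitfE -unitmxE.
  by apply: analytic_derivable; apply: analytic_det => k l; exact: transition_analytic.
apply: analytic_derivable; apply: analytic_mul; first exact: analytic_cst.
apply: analytic_det => k l; under eq_fun do rewrite !mxE.
exact: transition_analytic.
Qed.

(** Differentiating [Z t *m Y t = 1] gives the adjoint equation, with derivative
    [- (Z t *m A t)]. *)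
Lemma transition_inv_ode i j t :
  is_derive t (1 : R) (fun t => Z t i j) (\sum_l - A t l j * Z t i l).
Proof.
have [Phi1 dPhi] := Phi_tr.
pose dZ : 'M[R]_n := \matrix_(i, j) 'D_1 (fun t => Z t i j) t.
have E : dZ *m Y t + Z t *m (A t *m Y t) = 0.
  apply/matrixP => k l; rewrite [RHS]mxE.
  have H : is_derive t (1 : R) (fun t => (Z t *m Y t) k l)
      ((dZ *m Y t + Z t *m (A t *m Y t)) k l).
    under eq_fun do rewrite mxE.
    have -> : (dZ *m Y t + Z t *m (A t *m Y t)) k l =
        \sum_q (dZ k q * Y t q l + Z t k q * (A t *m Y t) q l).
      by rewrite big_split !mxE.
    apply: (is_derive_bigsum _ _ (fun q y => Z y k q * Y y q l)
      (fun q _ => dZ k q * Y t q l + Z t k q * (A t *m Y t) q l)) => q.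
    apply: is_derive_mul.
    by rewrite mxE; apply/derivableP; exact: transition_inv_derivable.
  apply: (is_derive_uniq _ _ _ _ H).
  have -> : (fun t => (Z t *m Y t) k l) = cst ((1%:M : 'M[R]_n) k l).
    by apply/funext => s; rewrite transition_invl.
  exact: is_derive_cst.
have dZE : dZ = - (Z t *m A t).
  apply/eqP; rewrite -addr_eq0; apply/eqP.
  by rewrite -[LHS]mulmx1 -(transition_invr t) mulmxA mulmxDl -!mulmxA E mul0mx.
have -> : \sum_l - A t l j * Z t i l = dZ i j.
  rewrite dZE !mxE -sumrN; apply: eq_bigr => l _; by rewrite mulNr mulrC.
by rewrite mxE; apply/derivableP; exact: transition_inv_derivable.
Qed.

Lemma transition_inv_analytic i j : analytic (fun t => Z t i j).
Proof.
have [AD HAD] := choice (fun p : 'I_n * 'I_n => real_analytic_jets _ (A_an p.1 p.2)).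
eexists; apply: (ode_jets n (fun i j t => - A t j i)
  (fun i j m t => -1 * AD (j, i) m t) _ (fun j t => Z t i j)) => [k l|k t].
  have := jets_mulc _ _ (-1) (HAD (l, k)).
  by under eq_fun do rewrite mulN1r.
exact: transition_inv_ode.
Qed.

Lemma transition_split t s : Phi t s = Y t *m Z s.
Proof. by rewrite transition_comp. Qed.

Let beta t := Z t *m b t.

Lemma beta_analytic i : analytic (fun t => beta t i 0).
Proof.
apply: analytic_mulmx => k l; first exact: transition_inv_analytic.
exact: real_analytic_jets (b_an k l).
Qed.

Section Sampled.
Variable B : 'I_n -> R -> R.
Hypothesis B_prim : forall i x, is_derive x (1 : R) (B i) (beta x i 0).

Definition sampled_increment (d : R) (k : int) : 'cV[R]_n :=
  \col_i (B i ((k + 1)%:~R * d) - B i (k%:~R * d)).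

(** The factor [Y] at the right end of the interval leaves the integral over [s]. *)
Lemma sampled_inputE d k : 0 < d ->
  samp_b Phi b d k = Y ((k + 1)%:~R * d) *m sampled_increment d k.
Proof.
move=> d0; apply/colP => i; rewrite /samp_b /vint !mxE.
set t1 := (k + 1)%:~R * d; set t0 := k%:~R * d.
have fE s : (Phi t1 s *m b s) i 0 = \sum_l Y t1 i l * beta s l 0.
  by rewrite transition_split -mulmxA mxE.
have -> : (fun s => (Phi t1 s *m b s) i 0) = (fun s => \sum_l Y t1 i l * beta s l 0).
  by apply/funext.
have cf : continuous (fun s => \sum_l Y t1 i l * beta s l 0).
  apply: analytic_continuous; apply: analytic_sum => l.
  by apply: analytic_mul; [exact: analytic_cst|exact: beta_analytic].
have dP x : is_derive x (1 : R) (fun s => \sum_l Y t1 i l * B l s)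
    (\sum_l Y t1 i l * beta x l 0).
  apply: (is_derive_bigsum _ _ (fun l s => Y t1 i l * B l s)
    (fun l s => Y t1 i l * beta s l 0)); exact: B_prim.
have t01 : t0 < t1 by rewrite ltr_pM2r // ltr_int ltrDl.
rewrite (integral_primitive _ _ _ _ cf dP t01) -sumrB.
by apply: eq_bigr => l _; rewrite mxE mulrBr.
Qed.

Lemma dtraj_sampled (c : R -> 'rV[R]_n) d F k m x : 0 < d ->
  dtraj (samp_A Phi d) (samp_b Phi b d) (samp_c c d) F k m x =
  Y ((k + m%:Z)%:~R * d) *m dtraj (fun=> 1%:M) (sampled_increment d)
     (fun k => c (k%:~R * d) *m Y (k%:~R * d)) F k m (Z (k%:~R * d) *m x).
Proof.
move=> d0; elim: m => [|m IH] /=.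
  by rewrite addr0 mulmxA transition_invr mul1mx.
rewrite IH; set z := dtraj _ _ _ _ _ m _; rewrite sampled_inputE // /samp_A /samp_c.
have -> : k + m.+1%:Z = k + m%:Z + 1 by lia.
set t1 := (k + m%:Z + 1)%:~R * d; set t0 := (k + m%:Z)%:~R * d.
rewrite transition_split !mulmxDl -!scalemxAl mulmxDr -scalemxAr mul1mx.
congr (_ + _ *: _); last by rewrite !mulmxA.
by rewrite -mulmxA [Z t0 *m _]mulmxA transition_invl mul1mx.
Qed.

Lemma sampled_nullifiable (c : R -> 'rV[R]_n) d : 0 < d ->
  unif_nullifiable (fun=> 1%:M) (sampled_increment d)
     (fun k => c (k%:~R * d) *m Y (k%:~R * d)) ->
  sample_nullifiable Phi b c d.
Proof.
move=> d0 [F [N H]]; exists F, N => k x.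
by rewrite dtraj_sampled // H mulmx0.
Qed.

End Sampled.

(** If [w] annihilates [beta], then [w *m Z t1] annihilates the contribution of every input.
    Steering the basis vector [l] to 0 and applying [w *m Z t1] leaves the entry [l] of [w], which
    is therefore 0. *)
Lemma controllable_free : lt_controllable Phi b -> forall w : 'rV[R]_n,
  (forall t, \sum_i w 0 i * beta t i 0 = 0) -> w = 0.
Proof.
move=> /(_ 0)[t1 t10 ctrl] w wb; apply/rowP => l; rewrite mxE.
have [u cu] := ctrl (delta_mx l 0).
set v := vint _ _ _ => E.
have wv : w *m (Z t1 *m v) = 0.
  apply/rowP => j; rewrite {j}ord1 [RHS]mxE mulmxA mxE.
  pose f i s := u s * \sum_l Y t1 i l * beta s l 0.
  have cf i : continuous (f i).
    have ca : continuous (fun s => \sum_l Y t1 i l * beta s l 0).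
      apply: analytic_continuous; apply: analytic_sum => q.
      by apply: analytic_mul; [exact: analytic_cst|exact: beta_analytic].
    by move=> s; apply: continuousM; [exact: cu|exact: ca].
  have [P HP] := choice (fun i => continuous_primitive _ (cf i)).
  have vE i : v i 0 = P i t1 - P i 0.
    rewrite /v /vint mxE -(integral_primitive _ _ _ _ (cf i) (HP i) t10).
    congr (Rintegral _ _ _); apply/funext => s.
    by rewrite mxE /f transition_split -mulmxA mxE.
  under eq_bigr do rewrite vE mulrBr.
  rewrite sumrB.
  pose q := w *m Z t1.
  have dQ x : is_derive x (1 : R) (fun s => \sum_i q 0 i * P i s)
      (\sum_i q 0 i * f i x).
    apply: (is_derive_bigsum _ _ (fun i s => q 0 i * P i s)
      (fun i s => q 0 i * f i s)); exact: HP.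
  have f0 x : \sum_i q 0 i * f i x = 0.
    have : (q *m (Y t1 *m beta x)) 0 0 = 0.
      rewrite /q -mulmxA [Z t1 *m _]mulmxA transition_invl mul1mx mxE; exact: wb.
    rewrite mxE => E0; under eq_bigr do rewrite /f mulrCA.
    rewrite -mulr_sumr -[RHS](mulr0 (u x)) -[in RHS]E0; congr (_ * _).
    by apply: eq_bigr => i _; rewrite [(Y t1 *m _) i 0]mxE.
  have [z [_ _ ->]] := MVT_sym _ _ 0 t1 dQ.
  by rewrite f0 mul0r.
have := congr1 (fun x => (w *m (Z t1 *m x)) 0 0) E.
rewrite !mulmxDr wv addr0 !mulmx0 [Z t1 *m _]mulmxA (transition_invl t1) mul1mx.
by rewrite -colE !mxE.
Qed.

Lemma observable_free c : lt_observable Phi c -> forall w : 'rV[R]_n,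
  (forall t, \sum_i w 0 i * (c t *m Y t) 0 i = 0) -> w = 0.
Proof.
move=> /(_ 0)[t1 t10 obs] w wc; apply: trmx_inj; rewrite trmx0; apply: obs => t _.
apply/colP => i; rewrite {i}ord1 mulmxA mxE [RHS]mxE -[RHS](wc t).
by apply: eq_bigr => j _; rewrite [w^T _ _]mxE mulrC.
Qed.

End System.
End Assembly.

(** Equal positive powers would force equal absolute values, impossible for consecutive integers. *)
Lemma consecutive_pow_neq (R : realType) (k : int) (p : nat) : (0 < p)%N ->
  ((k + 1)%:~R ^+ p - k%:~R ^+ p : R) != 0.
Proof.
move=> p0; rewrite subr_eq0; apply/eqP => E.
have : `|(k + 1)%:~R : R| = `|k%:~R|.
  by apply: (pexpIrn p0); rewrite ?nnegrE // -!normrX E.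
by rewrite -!intr_norm => /eqP; rewrite eqr_int; lia.
Qed.

(** * Countability of the exceptional periods *)

Section Final.
Context {R : realType} (n : nat) (A : R -> 'M[R]_n) (b : R -> 'cV[R]_n)
  (Phi : R -> R -> 'M[R]_n).
Hypothesis A_an : analytic_mx A.
Hypothesis b_an : analytic_mx b.
Hypothesis Phi_tr : transition_matrix A Phi.
Hypothesis ctrl : lt_controllable Phi b.

Let Y t := Phi t 0.
Let beta t := Phi 0 t *m b t.

Variable B : 'I_n -> R -> R.
Hypothesis B_prim : forall i x, is_derive x (1 : R) (B i) (beta x i 0).
Variable BD : 'I_n -> nat -> R -> R.
Hypothesis B_jets : forall i, jets (B i) (BD i).

(** Differentiation reduces this to [controllable_free]. The constant is included because increments
    determine [B] only up to one. *)
Lemma primitive_free (w : 'rV[R]_n) (w0 : R) :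
  (forall t, w0 + \sum_i w 0 i * B i t = 0) -> w0 = 0 /\ w = 0.
Proof.
move=> H; have w_eq0 : w = 0.
  apply: (controllable_free n A b Phi A_an b_an Phi_tr ctrl) => t.
  have H1 : is_derive t (1 : R) (fun t => \sum_i w 0 i * B i t)
      (\sum_i w 0 i * beta t i 0).
    by apply: (is_derive_bigsum _ _ (fun i s => w 0 i * B i s)
      (fun i s => w 0 i * beta s i 0)); exact: B_prim.
  apply: (is_derive_uniq _ _ _ _ H1).
  have -> : (fun t => \sum_i w 0 i * B i t) = cst (- w0).
    by apply/funext => s; apply/eqP; rewrite -addr_eq0 addrC H.
  exact: is_derive_cst.
split=> //; have := H 0; rewrite w_eq0 big1 ?addr0 // => i _.
by rewrite mxE mul0r.
Qed.

(** Order 0 is left out since increments do not see it. If all higher coefficients vanished, [B]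
    would be constant, against [primitive_free]. *)
Lemma first_jet : (0 < n)%N ->
  exists2 p, (0 < p)%N & (forall l m, (0 < m)%N -> (m < p)%N -> BD l m 0 = 0) /\
    exists l, BD l p 0 != 0.
Proof.
move=> n0.
have ex : exists m, (0 < m)%N && [exists l, BD l m 0 != 0].
  apply: contrapT => N.
  have BD0 l m : BD l m.+1 0 = 0.
    apply/eqP/negPn/negP => H; apply: N; exists m.+1 => /=.
    by apply/existsP; exists l.
  have Bc l t : B l t = B l 0.
    apply/eqP; rewrite -subr_eq0; apply/eqP.
    have jE := jets_add _ _ _ _ (B_jets l) (jets_cst (- B l 0)).
    apply: (jets_eq0 _ _ 0 jE) => -[|m] /=; last by rewrite BD0 addr0.
    by have [-> _ _] := B_jets l; rewrite subrr.
  pose l0 := Ordinal n0.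
  have H t : - B l0 0 + \sum_i (delta_mx 0 l0 : 'rV[R]_n) 0 i * B i t = 0.
    rewrite (bigD1 l0) //= big1 ?addr0 => [|i il0].
      by rewrite mxE !eqxx mul1r Bc addrC subrr.
    by rewrite mxE (negbTE il0) andbF mul0r.
  have [_] := primitive_free _ _ H.
  move/matrixP/(_ 0 l0); rewrite !mxE !eqxx => /eqP.
  by rewrite oner_eq0.
exists (ex_minn ex); case: ex_minnP => p /andP[p0 /existsP[l Bl]] pmin //.
split; last by exists l.
move=> l' m m0 mp; apply/eqP/negPn/negP => Bm.
have : (p <= m)%N by apply: pmin; rewrite m0; apply/existsP; exists l'.
by rewrite leqNgt mp.
Qed.

Lemma sampled_increment_leading l p k : (0 < p)%N ->
  (forall m, (0 < m)%N -> (m < p)%N -> BD l m 0 = 0) ->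
  leading (fun d => sampled_increment n B d k l 0) p
    (((k + 1)%:~R ^+ p - k%:~R ^+ p) * BD l p 0).
Proof.
move=> p0 Bm; under eq_fun do rewrite mxE.
have J1 := jets_scale _ _ (k + 1)%:~R (B_jets l).
have J2 := jets_mulc _ _ (-1) (jets_scale _ _ k%:~R (B_jets l)).
under eq_fun do rewrite [(k + 1)%:~R * _]mulrC [_%:~R * _]mulrC -[- _]mulN1r.
under eq_fun do rewrite ![_ * _%:~R]mulrC.
eexists; first exact: jets_add J1 J2.
split=> [[|m] mp|] /=; rewrite !mulr0.
- by rewrite !expr0 mulN1r subrr.
- by rewrite Bm // !mulr0 addr0.
- by rewrite mulN1r mulrBl.
Qed.

(** At [d = 0] the row vector is [c 0], whatever [i] is, so the leading coefficient is the
    hypothesised sum times a difference of consecutive powers. *)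
Lemma sampled_gain_zeros_countable c p i k : (0 < p)%N ->
  (forall l m, (0 < m)%N -> (m < p)%N -> BD l m 0 = 0) ->
  analytic_mx c -> \sum_l c 0 0 l * BD l p 0 != 0 ->
  countable_R [set d | dot (c (i%:~R * d) *m Y (i%:~R * d)) (sampled_increment n B d k) = 0].
Proof.
move=> p0 Bm c_an cB.
have [Phi1 _] := Phi_tr.
apply: (leading_countable_zeros _ (0 + p)
  (\sum_l c 0 0 l * (((k + 1)%:~R ^+ p - k%:~R ^+ p) * BD l p 0))); last first.
  under eq_bigr do rewrite mulrCA.
  by rewrite -mulr_sumr mulf_neq0 // consecutive_pow_neq.
under eq_fun do rewrite /dot mxE.
apply: (leading_sum _ _
  (fun l d => (c (i%:~R * d) *m Y (i%:~R * d)) 0 l * sampled_increment n B d k l 0)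
  _ (fun l => c 0 0 l * (((k + 1)%:~R ^+ p - k%:~R ^+ p) * BD l p 0))) => l.
apply: leading_mul (sampled_increment_leading l p k p0 (Bm l)).
have [D cD] : analytic (fun t => (c t *m Y t) 0 l).
  apply: analytic_mulmx => q r; first exact: real_analytic_jets (c_an q r).
  exact: (transition_analytic n A Phi A_an Phi_tr).
exists (fun m d => i%:~R ^+ m * D m (i%:~R * d)); first exact: jets_scale cD.
split=> //; rewrite mulr0 mul1r; have [-> _ _] := cD.
by rewrite /Y Phi1 mulmx1.
Qed.

(** If [q] annihilates consecutive increments, the combination of the [B l] with weights [q] takes
    one common value at the samples. Adjoining the function 1 to the [B l] turns this into a
    vanishing combination for [sampled_span]. *)
Lemma sampled_increment_span : exists L, forall k : int, countable_R [set d |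
  ~ forall q : 'rV[R]_n,
      (forall j : nat, (j < L)%N -> dot q (sampled_increment n B d (k + j%:Z)) = 0) -> q = 0].
Proof.
pose f (i : 'I_(1 + n)) t := if fintype.split i is inr l then B l t else 1.
have fE (w : 'rV[R]_(1 + n)) t :
    \sum_i w 0 i * f i t = w 0 (lshift n 0) + \sum_l w 0 (rshift 1 l) * B l t.
  rewrite big_split_ord big_ord1 /= /f.
  rewrite (unsplitK (inl _)) mulr1; congr (_ + _).
  by apply: eq_bigr => l _; rewrite (unsplitK (inr _)).
have [||L HL] := sampled_span (1 + n) f.
- move=> w wf; apply/rowP => i; rewrite mxE.
  have [t|w0 ws] := primitive_free (\row_l w 0 (rshift 1 l)) (w 0 (lshift n 0)).
    by rewrite -[RHS](wf t) fE; congr (_ + _); apply: eq_bigr => l _; rewrite mxE.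
  case: (split_ordP i) => [j ->|j ->]; first by rewrite ord1.
  by move/rowP/(_ j): ws; rewrite !mxE.
- move=> i; rewrite /f; case: (fintype.split i) => [_|l]; first exact: analytic_cst.
  by exists (BD l).
exists L => k; apply: countable_R_sub (HL k) => d /= Nd.
apply: contrapT => N; apply: Nd => q qg; apply/eqP/negPn/negP => q0; apply: N.
pose S j := \sum_l q 0 l * B l ((k + j%:Z)%:~R * d).
have SS j : (j < L)%N -> S j.+1 = S j.
  move=> jL; apply: subr0_eq; rewrite /S -sumrB -[RHS](qg j jL) /dot [RHS]mxE.
  have -> : k + j.+1%:Z = k + j%:Z + 1 by lia.
  by apply: eq_bigr => l _; rewrite [sampled_increment _ _ _ _ _ _]mxE mulrBr.
have Sc j : (j < L)%N -> S j = S 0%N.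
  elim: j => [//|j IH] jL; have jL' := ltnW jL.
  by rewrite (SS j jL') (IH jL').
exists (row_mx (- S 0%N)%:M q).
  apply: contra q0 => /eqP E; apply/eqP/rowP => l.
  by move/rowP/(_ (rshift 1 l)): E; rewrite row_mxEr !mxE.
move=> j jL; rewrite fE row_mxEl mxE eqxx mulr1n.
under eq_bigr do rewrite row_mxEr.
by rewrite -/(S j) (Sc j jL) addrC subrr.
Qed.

(** The exceptional periods lie in a union, over the integers and pairs of integers, of countable
    sets; off it the discrete theorem applies with window [Lg + Lh]. *)
Lemma nullifiable_countable c p : (0 < p)%N ->
  (forall l m, (0 < m)%N -> (m < p)%N -> BD l m 0 = 0) ->
  analytic_mx c -> \sum_l c 0 0 l * BD l p 0 != 0 -> lt_observable Phi c ->
  countable_R [set d | 0 < d /\ ~ sample_nullifiable Phi b c d].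
Proof.
move=> p0 Bm c_an cB obs.
have [Lg Hg] := sampled_increment_span.
have [||Lh Hh] := sampled_span n (fun i t => (c t *m Y t) 0 i).
- exact: (observable_free n Phi c obs).
- move=> l; apply: analytic_mulmx => q r; first exact: real_analytic_jets (c_an q r).
  exact: (transition_analytic n A Phi A_an Phi_tr).
have Hhg := fun x : int * int => sampled_gain_zeros_countable c p x.1 x.2 p0 Bm c_an cB.
have cU := countable_R_U _ _ (countable_R_exists _ _ Hg)
  (countable_R_U _ _ (countable_R_exists _ _ Hh) (countable_R_exists _ _ Hhg)).
apply: countable_R_sub cU => d /= [d0 Nd]; apply: contrapT => /not_orP[Ng /not_orP[Nh Nhg]].
apply: Nd; apply: (sampled_nullifiable n A b Phi A_an b_an Phi_tr B B_prim c d d0).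
apply: (unif_nullifiable_spanning _ _ (Lg + Lh)).
- move=> k q qg; apply: contrapT => q0; apply: Ng; exists k => H.
  by apply: q0; apply: H => j jL; apply: qg; lia.
- move=> k x hx; apply: contrapT => /eqP x0; apply: Nh; exists k, x^T.
    by apply: contra x0 => /eqP xT; rewrite -[x]trmxK xT trmx0.
  move=> j jL; have jL' : (j < Lg + Lh)%N by lia.
  rewrite -[RHS](hx j jL') /dot [RHS]mxE; apply: eq_bigr => l _.
  by rewrite [x^T _ _]mxE mulrC.
- move=> i j; apply/eqP => E; apply: Nhg; exists (i, j); exact: E.
Qed.

End Final.

Theorem theorem3 (R : realType) (n : nat)
    (A : R -> 'M[R]_n) (b : R -> 'cV[R]_n) (Phi : R -> R -> 'M[R]_n) :
  analytic_mx A -> analytic_mx b ->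
  transition_matrix A Phi ->
  lt_controllable Phi b ->
  exists G : set (R -> 'rV[R]_n),
    sup_open_dense G /\
    forall c : R -> 'rV[R]_n, G c -> lt_observable Phi c ->
      countable_R [set delta : R | 0 < delta /\
                     ~ sample_nullifiable Phi b c delta].
Proof.
move=> A_an b_an Phi_tr ctrl.
(* In dimension 0 every state is zero, and all analytic [c] qualify. *)
have [n0|n0] := posnP n.
  exists (fun c => analytic_mx c); split; first split=> //; first split.
  - by move=> c _; exists 1.
  - by move=> c c_an e e0; exists c => // t j; rewrite subrr normr0.
  - move=> c _ _; exists (fun=> 0) => d [_ []]; exists (fun=> 0), 0%N => k x.
    by apply/colP => i; suff : false by []; move: (ltn_ord i); rewrite {2}n0.
have beta_an := beta_analytic n A b Phi A_an b_an Phi_tr.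
have [B B_prim] := choice (fun i => continuous_primitive _
  (analytic_continuous _ (beta_an i))).
have [BD B_jets] := choice (fun i => primitive_analytic _ _ (beta_an i) (B_prim i)).
have [p p0 [Bm [l0 Bl0]]] :=
  first_jet n A b Phi A_an b_an Phi_tr ctrl B B_prim BD B_jets n0.
pose lin (c : R -> 'rV[R]_n) := \sum_l c 0 0 l * BD l p 0.
exists (fun c => analytic_mx c /\ lin c != 0); split; last first.
  move=> c [c_an cB] obs.
  exact: (nullifiable_countable n A b Phi A_an b_an Phi_tr ctrl B B_prim BD B_jets c p).
split; first by move=> c [].
split.
- move=> c [c_an cB]; pose s := \sum_l `|BD l p 0|.
  have s0 : 0 <= s by apply: sumr_ge0.
  (* A perturbation below this radius changes [lin c] by less than its absolute value; [1 + s]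
     avoids a zero denominator. *)
  exists (`|lin c| / (1 + s)); first by rewrite divr_gt0 ?normr_gt0 ?ltr_pwDl.
  move=> c' c'_an cc'; split=> //; apply/eqP => c'0.
  have : `|lin c| <= `|lin c| / (1 + s) * s.
    rewrite -[lin c]subr0 -{1}c'0 -normrN opprB /lin -sumrB.
    apply: le_trans (ler_norm_sum _ _ _) _.
    rewrite mulr_sumr; apply: ler_sum => l _.
    rewrite -mulrBl normrM ler_wpM2r // subr0; exact/ltW/cc'.
  have lc : 0 < `|lin c| by rewrite normr_gt0.
  rewrite -mulrA ler_pMr // leNgt => /negP; apply.
  by rewrite mulrC ltr_pdivrMr ?ltr_pwDl // mul1r ltrDr.
- move=> c c_an e e0; have [c0|c0] := eqVneq (lin c) 0; last first.
    by exists c => // t j; rewrite subrr normr0.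
  have e20 : 0 < e / 2 by rewrite divr_gt0.
  (* A constant shift of the entry [l0], where the coefficient is nonzero, moves [lin c] away from
     0. *)
  exists (fun t => c t + (e / 2) *: delta_mx 0 l0).
    split.
      move=> i j; under eq_fun do rewrite mxE.
      exact: real_analytic_addc (c_an i j).
    have -> : lin (fun t => c t + (e / 2) *: delta_mx 0 l0) = lin c + e / 2 * BD l0 p 0.
      rewrite /lin; under eq_bigr do rewrite !mxE mulrDl.
      rewrite big_split /=; congr (_ + _).
      rewrite (bigD1 l0) //= big1 ?addr0 => [|i il0]; first by rewrite !eqxx mulr1.
      by rewrite (negbTE il0) mulr0 mul0r.
    by rewrite c0 add0r mulf_neq0 // gt_eqF.
  move=> t j; rewrite mxE [c t 0 j + _]addrC addrK !mxE normrM gtr0_norm // normr_nat.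
  apply: (@le_lt_trans _ _ (e / 2)); last lra.
  by rewrite ler_piMr ?lern1 ?leq_b1 // ltW.
Qed.
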